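(* Let $(\Omega,\mathscr{F},\mathbb{P})$ be a probability space and let $\{X_n\}_{n\ge0}$, $\{M_n\}_{n\ge1}$ be $\mathbb{R}^d$-valued random variables satisfying, for every $n\ge0$, $$X_{n+1}-X_n-a(n)M_{n+1}\in a(n)F(X_n),$$ where: (A1) $F$ maps each $x\in\mathbb{R}^d$ to a nonempty convex compact subset $F(x)\subseteq\mathbb{R}^d$; there is $K>0$ with $\sup_{y\in F(x)}\|y\|\le K(1+\|x\|)$ for all $x$; and $F$ has closed graph, i.e. whenever $x_n\to x$, $y_n\in F(x_n)$, $y_n\to y$, then $y\in F(x)$; (A2) $\{a(n)\}_{n\ge0}$ are positive reals with $\sum_n a(n)=\infty$ and $\sum_n a(n)^2<\infty$; (A3) $\{M_n\}_{n\ge1}$ is a martingale difference sequence with respect to $\mathscr{F}_n:=\sigma(X_m,M_m,\ m\le n)$, and $\|M_{n+1}\|\le K(1+\|X_n\|)$ a.s. for every $n\ge0$, for some constant $K>0$; (A4) $A\subseteq\mathbb{R}^d$ is an attracting set of the differential inclusion $\dot x\in F(x)$ with fundamental neighborhood $\mathcal{O}$. Let $\mathcal{O}'$ be an open neighborhood of $A$ with $\overline{\mathcal{O}'}$ compact and $\overline{\mathcal{O}'}\subseteq\mathcal{O}$. Then there exist a constant $\tilde K>0$ (depending on $A$ and $\mathcal{O}'$) and $N_0\ge1$ such that for every $n_0\ge N_0$ and every event $E\in\mathscr{F}_{n_0}$ with $E\subseteq\{X_{n_0}\in\mathcal{O}'\}$ and $\mathbb{P}(E)>0$, $$\mathbb{P}\big(X_n\to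 A \text{ as } n\to\infty\ \big|\ E\big)\ge 1-2d\,e^{-\tilde K/b(n_0)},\qquad b(n):=\sum_{k=n}^\infty a(k)^2 .$$
   Context: A solution of the differential inclusion $\dot x\in F(x)$ with initial condition $x_0$ is an absolutely continuous $\mathbf{x}:\mathbb{R}\to\mathbb{R}^d$ with $\mathbf{x}(0)=x_0$ and $\dot{\mathbf{x}}(t)\in F(\mathbf{x}(t))$ for a.e. $t$. Its flow is $\Phi(t,x):=\{\mathbf{x}(t):\mathbf{x}\text{ a solution with }\mathbf{x}(0)=x\}$. A compact set $A$ is an attracting set if there is an open neighborhood $\mathcal{O}$ of $A$ (a fundamental neighborhood) such that for every $\epsilon>0$ there is $T>0$ with $\Phi(t,x)\subseteq N^\epsilon(A)$ for all $t\ge T$ and all $x\in\mathcal{O}$, where $N^\epsilon(A)$ is the open $\epsilon$-neighborhood of $A$. ''$X_n\to A$'' means $\operatorname{dist}(X_n,A)\to0$. *)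

(* Defs.v *)
From HB Require Import structures.
From mathcomp Require Import all_boot all_order all_algebra.
From mathcomp Require Import all_classical all_reals all_analysis.
Set Implicit Arguments. Unset Strict Implicit. Unset Printing Implicit Defensive.
Import Order.TTheory GRing.Theory Num.Theory.
Import numFieldNormedType.Exports.
Local Open Scope classical_set_scope.
Local Open Scope ring_scope.

(* Vectors of R^d are row vectors 'rV[R]_d with the library (sup) norm. *)

Definition convex_set_rV (R : realType) (d : nat) (S : set 'rV[R]_d) : Prop :=
  forall x y (l : R), S x -> S y -> 0 <= l -> l <= 1 ->
    S (l *: x + (1 - l) *: y).

Definition closed_graph (R : realType) (d : nat)
  (F : 'rV[R]_d -> set 'rV[R]_d) : Prop :=
  forall (x y : 'rV[R]_d) (xn yn : nat -> 'rV[R]_d),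
    xn @ \oo --> x -> yn @ \oo --> y -> (forall n, F (xn n) (yn n)) -> F x y.

Definition abs_continuous_R (R : realType) (d : nat) (x : R -> 'rV[R]_d) : Prop :=
  forall (a b e : R), 0 < e -> exists2 del : R, 0 < del &
    forall (n : nat) (s t : nat -> R),
      (forall k, (k < n)%N -> a <= s k /\ s k <= t k /\ t k <= b) ->
      (forall k, (k.+1 < n)%N -> t k <= s k.+1) ->
      \sum_(k < n) (t k - s k) < del ->
      \sum_(k < n) `|x (t k) - x (s k)| < e.

Definition DI_solution (R : realType) (d : nat)
  (F : 'rV[R]_d -> set 'rV[R]_d) (x0 : 'rV[R]_d) (x : R -> 'rV[R]_d) : Prop :=
  abs_continuous_R x /\ x 0 = x0 /\
  {ae (@lebesgue_measure R), forall t, derivable x t 1 /\ F (x t) ('D_1 x t)}.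

Definition DI_flow (R : realType) (d : nat) (F : 'rV[R]_d -> set 'rV[R]_d)
  (t : R) (x0 : 'rV[R]_d) : set 'rV[R]_d :=
  [set y | exists x, DI_solution F x0 x /\ x t = y].

Definition eps_nbhd (R : realType) (d : nat) (A : set 'rV[R]_d) (e : R)
  : set 'rV[R]_d := [set y | exists2 a, A a & `|y - a| < e].

Definition attracting_set_with (R : realType) (d : nat)
  (F : 'rV[R]_d -> set 'rV[R]_d) (A O : set 'rV[R]_d) : Prop :=
  compact A /\ open O /\ A `<=` O /\
  forall e : R, 0 < e -> exists2 T : R, 0 < T &
    forall t x, T <= t -> O x -> DI_flow F t x `<=` eps_nbhd A e.

Definition dist_set (R : realType) (d : nat) (x : 'rV[R]_d) (A : set 'rV[R]_d) : R :=
  inf [set `|x - a| | a in A].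

Definition rv_coord (R : realType) (d : nat) (T : Type) (Y : T -> 'rV[R]_d)
  (i : 'I_d) : T -> R := fun w => Y w ord0 i.

(** Natural filtration F_n = sigma(X_m, M_m : m <= n) (M indexed from 1). *)
Definition nat_filtration (dT : measure_display) (T : measurableType dT)
  (R : realType) (d : nat) (X M : nat -> T -> 'rV[R]_d) (n : nat)
  : set (set T) :=
  <<s [set E | exists m : nat, exists i : 'I_d, (m <= n)%N /\
        ((exists2 B : set R, measurable B & E = rv_coord (X m) i @^-1` B) \/
         ((1 <= m)%N /\ exists2 B : set R, measurable B &
                                         E = rv_coord (M m) i @^-1` B))] >>.

Definition tail_sq (R : realType) (a : nat -> R) (n : nat) : R :=
  limn (fun N => \sum_(n <= k < N) a k ^+ 2).

Definition cond_prob (dT : measure_display) (T : measurableType dT)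
  (R : realType) (P : probability T R) (C E : set T) : R :=
  fine (P (C `&` E)) / fine (P E).

(* Main.v *)
(** Interpolate the recursion by step functions on the time scale
    t_k = a_0 + ... + a_(k-1). When the steps and the partial sums of the noise are
    small, these functions almost solve the inclusion: over every interval the
    increment is nearly the length times a point of any convex set containing the
    values of F met on the way. Pointwise limits along an ultrafilter keep this
    property exactly; they are locally Lipschitz, hence differentiable almost
    everywhere, and upper semicontinuity puts the derivative in F. By contradiction,
    a trajectory started in O' with small steps and small noise is close to A after
    a fixed time, so it returns to O' again and again, stays bounded, and converges
    to A when the noise series converges.

    For the noise, e^u <= u + e^(2u^2) makes the exponential of the martingale,
    stopped when it exceeds a threshold, an almost-supermartingale. This gives
    the bound e^(-K/b(n0)) for each signed coordinate, and, since b(n) tends to 0,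
    almost sure convergence of the noise series on bounded trajectories. *)
Require Import Defs.
From HB Require Import structures.
From mathcomp Require Import all_boot all_order all_algebra.
From mathcomp Require Import all_classical all_reals all_analysis.
From mathcomp Require Import measurable_realfun ring lra.
Set Implicit Arguments. Unset Strict Implicit. Unset Printing Implicit Defensive.
Import Order.TTheory GRing.Theory Num.Theory.
Import numFieldNormedType.Exports HBNNSimple.
Local Open Scope classical_set_scope.
Local Open Scope ring_scope.

(** * Almost everywhere differentiability of Lipschitz functions *)

(** The obstacle is a circularity: the noise is bounded only where the states are, and the states
    are bounded only as long as the noise is small. It is broken by making the state bound part of
    the bad event ([noise_excursion]) and by a deterministic argument: before its first crossing of
    the threshold the noise is small, so the path stopped there can be continued without noise, and
    lock-in bounds every state up to the crossing. The state bound [C] is fixed before the step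
    sizes and [n0], hence so are the truncation level of the noise and the final constant. The
    threshold [rho] comes from a contradiction and is not explicit, but it is uniform over all step
    sequences and all starting points in the closure of [O']. So one estimate can be restarted at
    each return to [O'] by shifting indices. Step functions are not equicontinuous; an ultrafilter
    gives limits at all times at once, and the Lipschitz bound appears only in the limit. The factor
    [2 * d] counts signs and coordinates; the starting event [E] is carried through the integrals in
    place of conditioning. *)

Lemma lebesgue_stieltjes_itvoc (R : realType) (g : cumulative R R) (a b : R) :
  a <= b -> lebesgue_stieltjes_measure g `]a, b] = (g b - g a)%:E.
Proof.
move=> ab; rewrite /lebesgue_stieltjes_measure /measure_extension.
by rewrite measurable_mu_extE/=; [rewrite wlength_itv_bnd// EFinB|exact: is_ocitv].
Qed.

Lemma lipschitz_cvg (R : realType) (f : R -> R) (L : R) :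
  (forall s t, `|f s - f t| <= L * `|s - t|) -> forall x, f @ x --> f x.
Proof.
move=> Lf x; apply/cvgrPdist_lt => e e0.
have L0 : 0 < `|L| + 1 by rewrite ltr_wpDl.
exists (e / (`|L| + 1)) => /=; first by rewrite divr_gt0.
move=> y /= xy; apply: (le_lt_trans (Lf _ _)).
apply: (@le_lt_trans _ _ ((`|L| + 1) * `|x - y|)).
  by rewrite ler_wpM2r// (le_trans (ler_norm _))// lerDl.
by rewrite mulrC -ltr_pdivlMr.
Qed.

(* With g = f + t/2 and h = t/2 - f nondecreasing, the Stieltjes measures of g
   and h add up to Lebesgue measure, so that of g is absolutely continuous. *)
Lemma half_lipschitz_ae_derivable (R : realType) (f : R -> R) :
  (forall s t, `|f s - f t| <= 2^-1 * `|s - t|) ->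
  {ae (@lebesgue_measure R), forall t, derivable f t 1}.
Proof.
move=> Lf.
pose g0 t := f t + 2^-1 * t; pose h0 t := 2^-1 * t - f t.
have g_nd : {homo g0 : x y / x <= y}.
  move=> x y xy; rewrite /g0; have := Lf x y.
  by rewrite ler_norml ler0_norm ?subr_le0//; lra.
have h_nd : {homo h0 : x y / x <= y}.
  move=> x y xy; rewrite /h0; have := Lf x y.
  by rewrite ler_norml ler0_norm ?subr_le0//; lra.
have fc := lipschitz_cvg Lf.
have gc x : g0 @ x --> g0 x.
  by apply: cvgD; [exact: fc|apply: cvgMr; exact: cvg_id].
have hc x : h0 @ x --> h0 x.
  by apply: cvgB; [apply: cvgMr; exact: cvg_id|exact: fc].
pose g : cumulative R R := HB.pack g0
  (isCumulative.Build R _ _ g0 g_nd (right_continuousW gc)).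
pose h : cumulative R R := HB.pack h0
  (isCumulative.Build R _ _ h0 h_nd (right_continuousW hc)).
pose mug := lebesgue_stieltjes_measure g.
pose muh := lebesgue_stieltjes_measure h.
have gE a b : a <= b -> mug `]a, b]%classic = (g0 b - g0 a)%:E.
  exact: lebesgue_stieltjes_itvoc.
have hE a b : a <= b -> muh `]a, b]%classic = (h0 b - h0 a)%:E.
  exact: lebesgue_stieltjes_itvoc.
(* As [g0 + h0] is the identity, the two sides agree on half-open intervals, and these determine
   Lebesgue measure. *)
have sumE A : measurable A -> lebesgue_measure A = (mug A + muh A)%E.
  move=> mA; rewrite -(measure_addE mug muh).
  apply: lebesgue_measure_unique => // X.
  case=> [[a b]] _ <- /=.
  have [ab|ba] := leP a b; last first.
    by rewrite set_itv_ge ?measure0// bnd_simp -leNgt ltW.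
  apply: (etrans (lebesgue_stieltjes_itvoc idfun ab)); apply/esym.
  apply: (etrans (measure_addE _ _ _)).
  apply: (etrans (congr2 +%E (gE _ _ ab) (hE _ _ ab))).
  by rewrite -EFinD; congr (_%:E); rewrite /g0 /h0 /=; lra.
(* Restricting to a bounded interval makes the measure finite, as the Radon-Nikodym theorem used
   below asks. *)
have fin (N : R) : (mug `](- N)%R, N]%classic < +oo)%E.
  have [NN|NN] := leP (- N) N; first by rewrite gE// ltry.
  rewrite set_itv_ge; last by rewrite bnd_simp -leNgt ltW.
  by rewrite (_ : mug set0 = 0%E)//; exact: measure0.
pose nu (N : R) : {finite_measure set (measurableTypeR R) -> \bar R} :=
  @mfrestr _ (measurableTypeR R) R `](- N)%R, N]%classic mug (@measurable_itv R `](- N), N]) (fin N).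
have key (N : nat) : {ae (@lebesgue_measure R), forall t, - N%:R < t < N%:R -> derivable f t 1}.
  have dom : nu N%:R `<< (@lebesgue_measure R).
    apply/null_content_dominatesP => A mA A0.
    rewrite /nu /= /mfrestr /mrestr.
    apply/eqP; rewrite eq_le measure_ge0 andbT.
    apply: (@le_trans _ _ (mug A)); first by apply: le_measure; rewrite ?inE//; exact: measurableI.
    by rewrite -A0 [leRHS]sumE// leeDl.
  have [phi [phi0 phif phii phiE]] := radon_nikodym_sigma_finite dom.
  have phi_int : (@lebesgue_measure R).-integrable setT (EFin \o (fine \o phi)).
    by apply: eq_integrable phii => // t _ /=; rewrite fineK.
  have := @FTC1 R (fine \o phi) (BRight (- N%:R)).
  move=> /(_ _ _)/wrap[].
    by move=> y; apply: integrableS phi_int.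
    by apply: open_integrable_locally => //; exact: openT.
  apply: filterS; first exact: (ae_filter_ringOfSetsType (@lebesgue_measure R)).
  move=> t + /andP[Nt tN].
  move=> /(_ Nt)[+ _].
  (* Near [t] the integral of the density differs from [f] by an affine function, so
     differentiability of the integral passes to [f]. *)
  have nearE : \forall s \near t, (\int[lebesgue_measure]_(u in `](- N%:R), s]) (fine \o phi) u)%R = f s + (2^-1 * s - g0 (- N%:R)).
    near=> s.
    have Ns : - N%:R < s by near: s; exact: lt_nbhsr.
    have sN : s < N%:R by near: s; exact: lt_nbhsl.
    rewrite /Rintegral /=.
    under eq_integral do rewrite fineK//.
    rewrite -phiE//= /mfrestr /mrestr.
    rewrite setIidl; last first.
      by move=> u /=; rewrite !in_itv/= => /andP[-> /le_trans]; apply; exact: ltW.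
    transitivity (fine (mug `](- N%:R)%R, s]%classic)); first by [].
    rewrite gE; last exact: ltW.
    by rewrite /= /g0 addrA.
  move=> dF; have := near_eq_derivable nearE dF.
  have dl : derivable (fun s : R => 2^-1 * s - g0 (- N%:R)) t 1.
    have : derivable ((2^-1 : R) \*: (id : R -> R^o) - cst (g0 (- N%:R) : R^o)) t 1.
      apply: derivableB; last exact: derivable_cst.
      by apply: derivableZ; exact: derivable_id.
    by [].
  move=> /derivableB/(_ dl).
  by apply: near_eq_derivable; near=> s; rewrite /= !fctE addrK.
have /ae_foralln := key.
apply: filterS.
move=> t tN.
have [N tN'] : exists N : nat, `|t| < N%:R by exists (Num.truncn `|t|).+1; exact: truncnS_gt.
by apply: (tN N); rewrite -ltr_norml.
Unshelve. all: by end_near. Qed.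

(** Clamping the time to a bounded interval makes the function globally Lipschitz, and dividing by
    [2 * L] brings the constant to one half. Inside the interval the clamp is the identity, so
    derivatives there are unaffected. *)
Lemma locally_lipschitz_ae_derivable (R : realType) (f : R -> R) :
  (forall N : R, exists L, forall s t, `|s| <= N -> `|t| <= N ->
    `|f s - f t| <= L * `|s - t|) ->
  {ae (@lebesgue_measure R), forall t, derivable f t 1}.
Proof.
move=> locL.
have key (N : nat) : {ae (@lebesgue_measure R), forall t, `|t| < N%:R -> derivable f t 1}.
  have [L0 LL0] := locL N%:R.
  pose L := `|L0| + 1; have L_gt0 : 0 < L by rewrite ltr_wpDl.
  have LL s t : `|s| <= N%:R -> `|t| <= N%:R -> `|f s - f t| <= L * `|s - t|.
    move=> sN tN; apply: (le_trans (LL0 _ _ sN tN)).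
    by rewrite ler_wpM2r// (le_trans (ler_norm _))// lerDl.
  pose c (t : R) := Num.max (- N%:R) (Num.min N%:R t).
  have N0 : 0 <= N%:R :> R by [].
  have cN t : `|c t| <= N%:R.
    by rewrite ler_norml /c le_max lexx /= ge_max ge_min lexx /= andbT; lra.
  have cL s t : `|c s - c t| <= `|s - t|.
    have h1 := ler_norm (s - t); have h2 := lerNnormlW (lexx `|s - t|).
    move: `|s - t| h1 h2 => u h1 h2; rewrite ler_norml.
    by rewrite /c; case: (leP N%:R t) => ?; case: (leP N%:R s) => ?;
       rewrite ?(max_r (_ : - N%:R <= N%:R)); try lra; try case: (leP (- N%:R) s) => ?;
       try case: (leP (- N%:R) t) => ?;
       apply/andP; split; lra.
  have := @half_lipschitz_ae_derivable R (fun t => (2 * L)^-1 * f (c t)).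
  move=> /(_ _)/wrap[].
    move=> s t; rewrite -mulrBr normrM gtr0_norm ?invr_gt0 ?mulr_gt0//.
    rewrite invfM -mulrA ler_wpM2l// -(@ler_pM2l _ L)// mulVKf ?gt_eqF//.
    by apply: (le_trans (LL _ _ (cN s) (cN t))); rewrite ler_wpM2l// ltW.
  apply: filterS; first exact: (ae_filter_ringOfSetsType (@lebesgue_measure R)).
  move=> t dt tN; have := derivableZ (k := 2 * L) dt.
  apply: near_eq_derivable; near=> s.
  have : `|s| < N%:R.
    near: s; have := @norm_continuous _ R^o t.
    by move=> /(_ _ (lt_nbhsl tN)).
  rewrite ltr_norml => /andP[Ns sN].
  rewrite /= (_ : forall u : R, (2 * L) *: u = 2 * L * u)// mulrA mulfV ?mul1r ?mulf_neq0 ?gt_eqF//.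
  by rewrite /c min_r ?max_r// ltW.
have /ae_foralln := key.
apply: filterS.
move=> t tN.
by apply: (tN (Num.truncn `|t|).+1); exact: truncnS_gt.
Unshelve. all: by end_near. Qed.

(** * Approximate solutions of the inclusion *)

(* Testing against convex sets replaces averages of velocities, and makes the
   property stable under concatenation. *)
Definition near_inclusion (R : realType) (d : nat) (F : 'rV[R]_d -> set 'rV[R]_d)
  (L r s t : R) (z : R -> 'rV[R]_d) : Prop :=
  forall C : set 'rV[R]_d, convex_set_rV C ->
    (forall u, s <= u <= t -> F (z u) `<=` C) ->
    exists2 c, C c & `|c| <= L /\ `|z t - z s - (t - s) *: c| <= r.

Lemma convex_closed_ball (R : realType) (d : nat) (L : R) :
  convex_set_rV [set y : 'rV[R]_d | `|y| <= L].
Proof.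
move=> x y l /= xL yL l0 l1; apply: (le_trans (ler_normD _ _)).
rewrite !normrZ ger0_norm// ger0_norm ?subr_ge0//.
have l1' : 0 <= 1 - l by rewrite subr_ge0.
have := ler_wpM2l l0 xL; have := ler_wpM2l l1' yL; lra.
Qed.

Lemma convex_setI (R : realType) (d : nat) (A B : set 'rV[R]_d) :
  convex_set_rV A -> convex_set_rV B -> convex_set_rV (A `&` B).
Proof. by move=> cA cB x y l [? ?] [? ?] ? ?; split; [exact: cA|exact: cB]. Qed.

Lemma convex_weighted (R : realType) (d : nat) (C : set 'rV[R]_d) (x y : 'rV[R]_d) (p q : R) :
  convex_set_rV C -> C x -> C y -> 0 <= p -> 0 < q ->
  exists2 c, C c & p *: x + q *: y = (p + q) *: c.
Proof.
move=> cC Cx Cy p0 q0; have pq0 : 0 < p + q by lra.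
exists ((p / (p + q)) *: x + (1 - p / (p + q)) *: y).
  apply: cC => //; first by rewrite divr_ge0// ltW.
  by rewrite ler_pdivrMr// mul1r; lra.
rewrite scalerDr !scalerA; congr (_ *: _ + _ *: _); by field; rewrite gt_eqF.
Qed.

Lemma convex_weighted_sum (R : realType) (d : nat) (C : set 'rV[R]_d)
  (a : nat -> R) (y : nat -> 'rV[R]_d) (n m : nat) :
  convex_set_rV C -> (forall k, 0 < a k) -> (n < m)%N ->
  (forall k, (n <= k < m)%N -> C (y k)) ->
  exists2 c, C c &
    \sum_(n <= k < m) a k *: y k = (\sum_(n <= k < m) a k) *: c.
Proof.
move=> cC a0; elim: m => // m IH; rewrite ltnS leq_eqVlt => /predU1P[->{n IH}|nm] Cy.
  by exists (y m); [apply: Cy; rewrite leqnn ltnSn|rewrite !big_nat1].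
have [|c Cc cE] := IH nm; first by move=> k /andP[nk km]; apply: Cy; rewrite nk ltnW.
have [||c' Cc' c'E] := @convex_weighted _ _ C c (y m) (\sum_(n <= k < m) a k) (a m) cC Cc _ _ (a0 m).
- by apply: Cy; rewrite ltnW//=.
- by apply: sumr_ge0 => k _; exact: ltW.
exists c'; first exact: Cc'.
by rewrite big_nat_recr ?(ltnW nm)//= big_nat_recr ?(ltnW nm)//= cE c'E.
Qed.

(** The two mean velocities are averaged with the interval lengths as weights. The speed bound
    survives because [C] is first cut by the ball of radius [L], which is also convex. *)
Lemma near_inclusion_glue (R : realType) (d : nat) (F : 'rV[R]_d -> set 'rV[R]_d)
  (L r1 r2 s u t : R) (z : R -> 'rV[R]_d) : s <= u -> u <= t ->
  near_inclusion F L r1 s u z -> near_inclusion F L r2 u t z ->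
  near_inclusion F L (r1 + r2) s t z.
Proof.
move=> su ut H1 H2 C cC FC.
have [|c1 Cc1 [c1L E1]] := H1 C cC.
  by move=> v /andP[sv vu]; apply: FC; rewrite sv (le_trans vu).
have [|c2 Cc2 [c2L E2]] := H2 C cC.
  by move=> v /andP[uv vt]; apply: FC; rewrite vt (le_trans su).
(* The average needs a positive last weight, so an empty second interval is treated apart. *)
have [utE|ut'] := eqVneq u t.
  subst t; exists c1 => //; split => //; rewrite (le_trans E1)// lerDl.
  exact: le_trans (normr_ge0 _) E2.
have {}ut' : 0 < t - u by rewrite subr_gt0 lt_neqAle ut'.
have su' : 0 <= u - s by rewrite subr_ge0.
have [c [Cc cL] cE] := convex_weighted (convex_setI cC (@convex_closed_ball R d L))
   (conj Cc1 c1L) (conj Cc2 c2L) su' ut'.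
exists c => //; split => //; rewrite (_ : t - s = u - s + (t - u)); last by ring.
rewrite -cE (_ : z t - z s - _ = (z u - z s - (u - s) *: c1) + (z t - z u - (t - u) *: c2)).
  by rewrite (le_trans (ler_normD _ _))// lerD.
by apply/rowP => i; rewrite !mxE; ring.
Qed.

(* [S] carries the partial sums of the noise; only its increments matter. *)
Definition DI_path (R : realType) (d : nat) (F : 'rV[R]_d -> set 'rV[R]_d)
  (a : nat -> R) (x S : nat -> 'rV[R]_d) : Prop :=
  forall k, exists2 y, F (x k) y & x k.+1 = x k + a k *: y + (S k.+1 - S k).

Definition path_time (R : realType) (a : nat -> R) (k : nat) : R := \sum_(0 <= i < k) a i.

Lemma path_time_interval (R : realType) (a : nat -> R) : (forall k, 0 < a k) ->
  (forall B, exists k, B < path_time a k) ->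
  exists kappa : R -> nat, forall t, 0 <= t ->
    path_time a (kappa t) <= t < path_time a (kappa t).+1.
Proof.
move=> a0 div.
suff H t : exists k, 0 <= t -> path_time a k <= t < path_time a k.+1.
  by have [kappa Hk] := choice H; exists kappa.
have [k tk] : exists k, t < path_time a k by exact: div.
have [t0|] := leP 0 t; last by exists 0%N.
have := ex_minnP (ex_intro (fun k => t < path_time a k) k tk); case=> -[|m] tm mmin.
  by move: tm; rewrite /path_time big_geq// ltNge t0.
exists m => _; rewrite tm andbT leNgt; apply/negP => /mmin; by rewrite ltnn.
Qed.

Lemma path_time_mono (R : realType) (a : nat -> R) : (forall k, 0 < a k) ->
  {mono path_time a : m n / (m <= n)%N >-> m <= n}.
Proof.
move=> a0; apply: le_mono; apply: homo_ltn => [|k]; first exact: lt_trans.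
by rewrite /path_time big_nat_recr//= ltrDl.
Qed.

(** Discrete Gronwall for the path with its noise removed: the denoised state differs from [x k] by
    at most 1, so 2 plus its norm grows by a factor of at most [1 + K * a k], hence at most the
    exponential of [K * a k], in each step. *)
Lemma path_gronwall (R : realType) (d : nat) (F : 'rV[R]_d -> set 'rV[R]_d)
  (a : nat -> R) (x S : nat -> 'rV[R]_d) (K B : R) :
  0 < K -> (forall u v, F u v -> `|v| <= K * (1 + `|u|)) ->
  (forall k, 0 < a k) -> DI_path F a x S -> (forall k, `|S k - S 0%N| <= 1) ->
  `|x 0%N| <= B ->
  forall k, 1 + `|x k| <= (2 + B) * expR (K * path_time a k).
Proof.
move=> K0 FK a0 xS S1 x0B k.
suff H : 2 + `|x k - (S k - S 0%N)| <= (2 + B) * expR (K * path_time a k).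
  have := ler_normD (x k - (S k - S 0%N)) (S k - S 0%N); rewrite subrK.
  by have := S1 k; lra.
elim: k => [|k IH].
  by rewrite subrr subr0 /path_time big_geq// mulr0 expR0 mulr1 lerD2l.
have [y Fy ->] := xS k.
rewrite /path_time big_nat_recr//= -/(path_time a k) mulrDr expRD mulrA.
have -> : x k + a k *: y + (S k.+1 - S k) - (S k.+1 - S 0%N) =
   (x k - (S k - S 0%N)) + a k *: y.
  by apply/rowP => i; rewrite !mxE; ring.
set u := x k - (S k - S 0%N) in IH *.
have yle : `|y| <= K * (2 + `|u|).
  apply: (le_trans (FK _ _ Fy)); rewrite ler_pM2l// -{1}(subrK (S k - S 0%N) (x k)) -/u.
  by have := ler_normD u (S k - S 0%N); have := S1 k; lra.
have e1 : 1 + K * a k <= expR (K * a k) by exact: expR_ge1Dx.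
apply: (@le_trans _ _ ((2 + `|u|) * expR (K * a k))); last by rewrite ler_wpM2r// expR_ge0.
apply: (@le_trans _ _ ((2 + `|u|) * (1 + K * a k))); last by rewrite ler_wpM2l// addr_ge0.
have := ler_normD u (a k *: y); rewrite normrZ gtr0_norm//.
have := ler_wpM2l (ltW (a0 k)) yle; lra.
Qed.

(** The factor of [eta] in the defect is the Gronwall speed bound on the window. [eta] times this
    speed pays for [s] and [t] not being grid times, and [rho] pays for the noise. *)
Lemma path_interpolation (R : realType) (d : nat) (F : 'rV[R]_d -> set 'rV[R]_d)
  (a : nat -> R) (x S : nat -> 'rV[R]_d) (K B eta rho : R) :
  0 < K -> (forall u v, F u v -> `|v| <= K * (1 + `|u|)) ->
  (forall k, 0 < a k) -> (forall C, exists k, C < path_time a k) ->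
  (forall k, a k <= eta) -> DI_path F a x S ->
  (forall j k, `|S j - S k| <= rho) -> rho <= 1 -> `|x 0%N| <= B ->
  exists z : R -> 'rV[R]_d,
    [/\ forall k, z (path_time a k) = x k,
        forall t, 0 <= t -> 1 + `|z t| <= (2 + B) * expR (K * t) &
        forall N s t, 0 <= s -> s <= t -> t <= N ->
          near_inclusion F (K * ((2 + B) * expR (K * N)))
            (eta * (K * ((2 + B) * expR (K * N))) + rho) s t z].
Proof.
move=> K0 FK a0 div aeta xS Srho rho1 x0B.
have [kappa kappaP] := path_time_interval a0 div.
have tmono := path_time_mono a0.
have tmono' : {mono path_time a : m n / (m < n)%N >-> m < n} := leW_mono tmono.
have B0 : 0 <= B by rewrite (le_trans _ x0B).
have G k : 1 + `|x k| <= (2 + B) * expR (K * path_time a k).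
  by apply: (path_gronwall K0 FK a0 xS _ x0B) => j; rewrite (le_trans (Srho _ _)).
have kappa_t k : kappa (path_time a k) = k.
  have t0 : 0 <= path_time a k by rewrite sumr_ge0// => i _; exact: ltW.
  have /andP[] := kappaP _ t0; rewrite tmono tmono' ltnS => h1 h2.
  by apply/eqP; rewrite eqn_leq h1.
have Gmono p q : p <= q -> (2 + B) * expR (K * p) <= (2 + B) * expR (K * q).
  by move=> pq; rewrite ler_wpM2l ?addr_ge0// ler_expR ler_pM2l.
exists (x \o kappa); split=> [k|t t0|N s t s0 st tN C cC FC] /=.
- by rewrite kappa_t.
- by rewrite (le_trans (G _))// Gmono//; have /andP[] := kappaP _ t0.
have t0 := le_trans s0 st.
have /andP[ns sn] := kappaP _ s0; have /andP[mt tm] := kappaP _ t0.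
set L := K * _; set n := kappa s in ns sn *; set m := kappa t in mt tm *.
have nm : (n <= m)%N by rewrite -ltnS -tmono'; exact: (le_lt_trans (le_trans ns st) tm).
have yex k : exists v, F (x k) v /\ x k.+1 = x k + a k *: v + (S k.+1 - S k).
  by have [v Fv E] := xS k; exists v.
have [y yP] := choice yex.
have Fy k := (yP k).1; have yE k := (yP k).2.
have xmE : x m - x n = \sum_(n <= k < m) a k *: y k + (S m - S n).
  have -> : x m - x n = \sum_(n <= k < m) (x k.+1 - x k) by rewrite telescope_sumr.
  rewrite -(telescope_sumr S nm) -big_split/=; apply: eq_bigr => k _; rewrite yE.
  by apply/rowP => i; rewrite !mxE; ring.
have yC k : (n <= k <= m)%N -> C (y k) /\ `|y k| <= L.
  move=> /andP[nk km]; have tkt : path_time a k <= t by rewrite (le_trans _ mt)// tmono.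
  split.
    (* The grid time of [n] may precede [s], but [x n] is still the value of the step function at
       [s]; later indices have grid times inside the interval. *)
    move: nk; rewrite leq_eqVlt => /predU1P[nk|nk].
      by apply: (FC s); [rewrite lexx st|rewrite /= -/n nk].
    apply: (FC (path_time a k)); last by rewrite /= kappa_t.
    by rewrite tkt andbT ltW// (lt_le_trans sn)// tmono.
  rewrite (le_trans (FK _ _ (Fy k)))// ler_pM2l// (le_trans (G k))// Gmono//.
  exact: le_trans tN.
have [c [Cc cL] cE] : exists2 c, (C `&` [set v | `|v| <= L]) c &
    \sum_(n <= k < m) a k *: y k = (path_time a m - path_time a n) *: c.
  have [nm'|] := ltnP n m; last first.
    move=> mn; have {mn} <- : n = m by apply/eqP; rewrite eqn_leq nm.
    by exists (y n); [apply: yC; rewrite leqnn|rewrite big_geq// subrr scale0r].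
  have [k /andP[nk km]|c Cc cE] := convex_weighted_sum
      (convex_setI cC (@convex_closed_ball R d L)) a0 nm' (y := y).
    by apply: yC; rewrite nk ltnW.
  exists c => //; rewrite cE; congr (_ *: _).
  by apply/esym/eqP; rewrite subr_eq addrC /path_time -big_cat_nat// ltnW.
exists c => //; split => //.
rewrite xmE cE.
have -> : (path_time a m - path_time a n) *: c + (S m - S n) - (t - s) *: c =
  ((s - path_time a n) - (t - path_time a m)) *: c + (S m - S n).
  by apply/rowP => i; rewrite !mxE; ring.
rewrite (le_trans (ler_normD _ _))// lerD// normrZ ler_pM//.
(* Both offsets from the grid lie between 0 and [eta], so their difference is at most [eta] in
   absolute value. *)
move: (aeta n) (aeta m) sn tm; rewrite /path_time !big_nat_recr//= -!/(path_time _ _) => ? ? ? ?.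
by rewrite ler_norml; apply/andP; split; lra.
Qed.

(** Noise-free Euler paths serve to continue a given path, backward in time and beyond a stopping
    index. *)
Lemma DI_path_exists (R : realType) (d : nat) (F : 'rV[R]_d -> set 'rV[R]_d)
  (a : nat -> R) (x0 : 'rV[R]_d) : (forall u, F u !=set0) ->
  exists2 w, w 0%N = x0 & DI_path F a w (fun=> 0).
Proof.
move=> F0; have [f Ff] := choice F0.
pose w := fix w k := if k is j.+1 then w j + a j *: f (w j) else x0.
by exists w => // k; exists (f (w k)) => //=; rewrite subrr addr0.
Qed.

(** Solutions live on the whole real line, so the approximations need a past as well. Gluing the two
    halves at time 0 doubles the defect. *)
Lemma path_interpolation_line (R : realType) (d : nat) (F : 'rV[R]_d -> set 'rV[R]_d)
  (a : nat -> R) (x S : nat -> 'rV[R]_d) (K B eta rho : R) :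
  (forall u, F u !=set0) ->
  0 < K -> (forall u v, F u v -> `|v| <= K * (1 + `|u|)) ->
  (forall k, 0 < a k) -> (forall C, exists k, C < path_time a k) ->
  (forall k, a k <= eta) -> DI_path F a x S ->
  (forall j k, `|S j - S k| <= rho) -> rho <= 1 -> `|x 0%N| <= B ->
  exists z : R -> 'rV[R]_d,
    [/\ forall k, z (path_time a k) = x k,
        forall t, 1 + `|z t| <= (2 + B) * expR (K * `|t|) &
        forall N s t, - N <= s -> s <= t -> t <= N ->
          near_inclusion F (K * ((2 + B) * expR (K * N)))
            (2 * (eta * (K * ((2 + B) * expR (K * N))) + rho)) s t z].
Proof.
move=> F0 K0 FK a0 div aeta xS Srho rho1 x0B.
have [z1 [z1x z1G z1F]] := path_interpolation K0 FK a0 div aeta xS Srho rho1 x0B.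
(* Reversing time changes the sign of velocities, so the past is a forward path for the negated
   inclusion. *)
pose F' u := [set y | F u (- y)].
have [u|w w0 wP] := @DI_path_exists R d F' a (x 0%N).
  by have [y Fy] := F0 u; exists (- y); rewrite /F' /= opprK.
have [|||z2 [z2x z2G z2F]] := path_interpolation (rho := rho) (B := B) K0 _ a0 div aeta wP _ rho1.
- by move=> u v /FK; rewrite normrN.
- by move=> j k; rewrite subrr normr0 (le_trans _ (Srho 0%N 0%N)).
- by rewrite w0.
have z12 : z1 0 = z2 0.
  have := z1x 0%N; have := z2x 0%N; rewrite /path_time big_geq// => -> ->.
  by rewrite w0.
pose z t := if 0 <= t then z1 t else z2 (- t).
have zneg t : t <= 0 -> z t = z2 (- t).
  rewrite /z; have [t0|//] := leP 0 t; move=> t0'.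
  have -> : t = 0 by apply/le_anti; rewrite t0 t0'.
  by rewrite oppr0.
have zpos t : 0 <= t -> z t = z1 t by rewrite /z => ->.
exists z; split=> [k|t|N s t Ns st tN].
- by rewrite zpos// sumr_ge0// => i _; exact: ltW.
- have [t0|t0] := leP 0 t; first by rewrite zpos// (ger0_norm t0) z1G.
  by rewrite (zneg _ (ltW t0)) (ltr0_norm t0) z2G // oppr_ge0 ltW.
set L := K * _; set r := eta * L + rho.
have N0 : 0 <= N by lra.
have L0 : 0 <= L.
  by rewrite mulr_ge0 ?(ltW K0)// mulr_ge0 ?expR_ge0// addr_ge0// (le_trans _ x0B).
have r0 : 0 <= r.
  rewrite addr_ge0 ?(le_trans _ (Srho 0%N 0%N))// mulr_ge0//.
  exact: le_trans (ltW (a0 0%N)) (aeta 0%N).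
have pos s' t' : 0 <= s' -> s' <= t' -> t' <= N -> near_inclusion F L r s' t' z.
  move=> s0 st' t'N C cC FC; rewrite !zpos//; last exact: le_trans st'.
  apply: z1F => // u /[dup] su /andP[s'u _].
  by rewrite -zpos ?(le_trans s0)//; exact: FC.
have neg s' t' : - N <= s' -> s' <= t' -> t' <= 0 -> near_inclusion F L r s' t' z.
  move=> Ns' st' t0 C cC FC; rewrite !zneg//; last exact: le_trans st' t0.
  have [|||||c Cc [cL cE]] := z2F N (- t') (- s') _ _ _ [set y | C (- y)].
  - by rewrite oppr_ge0.
  - by rewrite lerN2.
  - by rewrite lerNl.
  - move=> p q l Cp Cq l0 l1 /=; rewrite opprD -!scalerN; exact: cC.
  - move=> u /andP[tu us] y; rewrite /F' /= => Fy.
    apply: (FC (- u)); last by rewrite zneg ?opprK// oppr_le0 (le_trans _ tu)// oppr_ge0.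
    by rewrite lerNr us lerNl tu.
  exists (- c) => //; split; first by rewrite normrN.
  rewrite (_ : z2 (- t') - _ - _ = - (z2 (- s') - z2 (- t') - (- s' - - t') *: c)).
    by rewrite normrN.
  by apply/rowP => i; rewrite !mxE; ring.
have weak s' t' : near_inclusion F L r s' t' z -> near_inclusion F L (2 * r) s' t' z.
  move=> H C cC FC; have [c Cc [cL cE]] := H C cC FC; exists c => //; split => //.
  by rewrite (le_trans cE)// ler_peMl// ler1n.
have [s0|s0] := leP 0 s; first by apply: weak; exact: pos.
have [t0|t0] := leP t 0; first by apply: weak; exact: neg.
rewrite mulr2n mulrDl mul1r.
by apply: (@near_inclusion_glue _ _ _ _ _ _ _ 0); [exact: ltW|exact: ltW|apply: neg => //; exact: ltW|apply: pos => //; exact: ltW].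
Qed.

(** * Limits of approximate solutions *)

(** One ultrafilter serves all times, starting points and hitting times simultaneously, so no
    diagonal subsequence is extracted. *)
Lemma compact_ultra_cvg (T : ptopologicalType) (U : set_system nat) (C : set T) (v : nat -> T) :
  UltraFilter U -> compact C -> (forall j, C (v j)) -> exists l : T, C l /\ v @ U --> l.
Proof.
move=> UU cC vC.
have UC : \forall j \near U, C (v j) by exact: nearW vC.
have [p [Cp clp]] := cC (v @ U) _ UC.
exists p; split => // W Wp; have [//|FnW] := in_ultra_setVsetC (v @^-1` W) UU.
by have [y [ny]] := clp (~` W) W FnW Wp.
Qed.

Lemma bounded_ultra_cvg (R : realType) (d : nat) (U : set_system nat) (v : nat -> 'rV[R]_d) (B : R) :
  UltraFilter U -> (forall j, `|v j| <= B) -> exists l : 'rV[R]_d, v @ U --> l.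
Proof.
move=> UU vB.
have cB : compact [set y : 'rV[R]_d | `|y| <= B].
  apply: bounded_closed_compact.
    by exists B; split; [exact: num_real|move=> M BM y /= yB; rewrite (le_trans yB)// ltW].
  have -> : [set y : 'rV[R]_d | `|y| <= B] = (fun y => `|y|) @^-1` [set r | r <= B] by [].
  apply: closed_comp; last exact: closed_le.
  by move=> y _; exact: norm_continuous.
by have [l [_ vl]] := compact_ultra_cvg UU cB vB; exists l.
Qed.

(* Upper semicontinuity, from the sequential closed graph and local boundedness. *)
Lemma closed_graph_usc (R : realType) (d : nat) (F : 'rV[R]_d -> set 'rV[R]_d) (K : R) :
  closed_graph F -> 0 < K -> (forall u v, F u v -> `|v| <= K * (1 + `|u|)) ->
  forall x e, 0 < e -> exists2 del, 0 < del &
    forall v, `|v - x| < del -> forall y, F v y -> exists2 f, F x f & `|y - f| <= e.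
Proof.
move=> clF K0 FK x e e0; apply: contrapT => /forall2NP H.
have bad n : exists vy : 'rV[R]_d * 'rV[R]_d, [/\ `|vy.1 - x| < n.+1%:R^-1, F vy.1 vy.2 &
    forall f, F x f -> e < `|vy.2 - f|].
  have [//|] := H n.+1%:R^-1.
  move=> /existsNP[v /not_implyP[vx /existsNP[y /not_implyP[Fvy Hy]]]].
  exists (v, y); split => //= f Fxf; rewrite ltNge; apply/negP => yf.
  by apply: Hy; exists f.
have [w wP] := choice bad.
have [U [UU ooU]] := @ultraFilterLemma nat \oo _.
have [|l wl] := @bounded_ultra_cvg R d U (fun n => (w n).2) (K * (2 + `|x|)) UU.
  move=> n; have [w1 w2 _] := wP n; rewrite (le_trans (FK _ _ w2))// ler_pM2l//.
  have n1 : n.+1%:R^-1 <= 1 :> R by rewrite invf_le1 ?ler1n.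
  by have := ler_normD ((w n).1 - x) x; rewrite subrK; have := lt_le_trans w1 n1; lra.
(* [closed_graph] speaks of sequences, so a genuine sequence converging to the ultrafilter limit [l]
   is selected; [k <= n] also forces the base points to converge to [x]. *)
have pick_ k : exists n, (k <= n)%N /\ `|(w n).2 - l| < k.+1%:R^-1.
  have k0 : 0 < k.+1%:R^-1 :> R by rewrite invr_gt0.
  have near1 : \forall n \near U, `|(w n).2 - l| < k.+1%:R^-1.
    by move/cvgrPdist_lt : wl => /(_ _ k0); apply: filterS => n; rewrite distrC.
  have near2 : \forall n \near U, (k <= n)%N by apply: ooU; exact: nbhs_infty_ge.
  by have [n [? ?]] := filter_ex (filterI near1 near2); exists n.
have [sub subP] := choice pick_.
have inv_cvg : (fun k : nat => k.+1%:R^-1 : R) @ \oo --> (0 : R) by exact: cvg_harmonic.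
have cvg_of (u : nat -> 'rV[R]_d) p : (forall k, `|u k - p| <= k.+1%:R^-1) -> u @ \oo --> p.
  move=> up; apply/cvgrPdist_lt => r r0.
  move/cvgrPdist_lt : inv_cvg => /(_ _ r0); apply: filterS => k /=.
  rewrite sub0r normrN ger0_norm// => kr; rewrite distrC; exact: le_lt_trans kr.
have Fxl : F x l.
  apply: (clF x l (fun k => (w (sub k)).1) (fun k => (w (sub k)).2)).
  - apply: cvg_of => k; have [w1 _ _] := wP (sub k); rewrite (le_trans (ltW w1))//.
    by rewrite lef_pV2 ?posrE// ler_nat ltnS; exact: (subP k).1.
  - by apply: cvg_of => k; exact: ltW (subP k).2.
  - by move=> k; have [_ ? _] := wP (sub k).
have /filter_ex[k /=] : \forall k \near \oo, `|l - (w (sub k)).2| < e.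
  have : (fun k => (w (sub k)).2) @ \oo --> l.
    by apply: cvg_of => k; exact: ltW (subP k).2.
  by move=> /cvgrPdist_lt/(_ _ e0).
have [_ _ /(_ _ Fxl)] := wP (sub k); rewrite distrC => h1 h2.
by have := lt_trans h1 h2; rewrite ltxx.
Qed.

(** Enlargements of [F x] are the test sets that capture all velocities at points near [x]. *)
Lemma convex_enlargement (R : realType) (d : nat) (C : set 'rV[R]_d) (e : R) :
  convex_set_rV C -> convex_set_rV [set y | exists2 f, C f & `|y - f| <= e].
Proof.
move=> cC x y l [f Cf xf] [g Cg yg] l0 l1.
exists (l *: f + (1 - l) *: g); first exact: cC.
have l1' : 0 <= 1 - l by rewrite subr_ge0.
rewrite (_ : _ - _ = l *: (x - f) + (1 - l) *: (y - g)); last first.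
  by apply/rowP => i; rewrite !mxE; ring.
rewrite (le_trans (ler_normD _ _))// !normrZ !ger0_norm//.
by have := ler_wpM2l l0 xf; have := ler_wpM2l l1' yg; lra.
Qed.

Lemma locally_lipschitz_AC (R : realType) (d : nat) (x : R -> 'rV[R]_d) :
  (forall N : R, exists L, forall s t, - N <= s -> s <= t -> t <= N ->
    `|x t - x s| <= L * (t - s)) -> abs_continuous_R x.
Proof.
move=> lip a b e e0.
have [L LP] := lip (Num.max `|a| `|b|).
pose L' := `|L| + 1; have L'0 : 0 < L' by rewrite ltr_wpDl.
exists (e / L'); first by rewrite divr_gt0.
move=> n s t stb _ sum_lt.
apply: (@le_lt_trans _ _ (\sum_(k < n) L' * (t k - s k))).
  apply: ler_sum => k _; have [ak [kk kb]] := stb k (ltn_ord k).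
  apply: (@le_trans _ _ (L * (t k - s k))).
    apply: LP => //; last by rewrite (le_trans kb)// le_max (ler_norm b) orbT.
    by rewrite (le_trans _ ak)// lerNl le_max -normrN ler_norm.
  by rewrite ler_wpM2r ?subr_ge0// (le_trans (ler_norm L))// lerDl.
by rewrite -mulr_sumr mulrC -ltr_pdivlMr.
Qed.

Lemma locally_lipschitz_row_ae_derivable (R : realType) (d : nat) (x : R -> 'rV[R]_d) :
  (forall N : R, exists L, forall s t, - N <= s -> s <= t -> t <= N ->
    `|x t - x s| <= L * (t - s)) ->
  {ae (@lebesgue_measure R), forall t, derivable x t 1}.
Proof.
move=> lip.
have coord i : {ae (@lebesgue_measure R), forall t, derivable (fun s => x s ord0 i) t 1}.
  apply: locally_lipschitz_ae_derivable => N; have [L LP] := lip N; exists L.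
  have le_coord (y : 'rV[R]_d) : `|y ord0 i| <= `|y|.
    by rewrite [leRHS]/Num.Def.normr/= mx_normrE (le_bigmax _ _ (ord0, i)).
  have H s t : `|s| <= N -> `|t| <= N -> s <= t -> `|x t ord0 i - x s ord0 i| <= L * `|t - s|.
    move=> sN' tN' st.
    have /andP[sN _] : - N <= s <= N by rewrite -ler_norml.
    have /andP[_ tN] : - N <= t <= N by rewrite -ler_norml.
    have ts0 : 0 <= t - s by rewrite subr_ge0.
    rewrite (ger0_norm ts0).
    apply: (le_trans _ (LP _ _ sN st tN)).
    by have := le_coord (x t - x s); rewrite !mxE.
  move=> s t sN tN; have [st|/ltW ts] := leP s t; last exact: H.
  by rewrite distrC [`|s - t|]distrC; exact: H.
(* The coordinates are indexed through natural numbers so that the countable intersection of sets of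
   full measure applies. *)
have : {ae (@lebesgue_measure R), forall t, forall n : nat,
    forall i : 'I_d, nat_of_ord i = n -> derivable (fun s => x s ord0 i) t 1}.
  apply/ae_foralln => n; have [nd|dn] := ltnP n d.
    have := coord (Ordinal nd); apply: filterS; first exact: (ae_filter_ringOfSetsType (@lebesgue_measure R)).
    move=> t dt i E.
    by rewrite (_ : i = Ordinal nd)//; exact: val_inj.
  apply: aeW.
  by move=> t i E; move: dn; rewrite -E leqNgt ltn_ord.
apply: filterS; first exact: (ae_filter_ringOfSetsType (@lebesgue_measure R)).
move=> t dt; apply/derivable_mxP => i j.
by rewrite ord1; exact: dt.
Qed.

(** Testing against the whole space leaves only the speed bound, with [r] as defect. *)
Lemma near_inclusion_lipschitz (R : realType) (d : nat) (F : 'rV[R]_d -> set 'rV[R]_d)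
  (L r s t : R) (z : R -> 'rV[R]_d) : s <= t -> near_inclusion F L r s t z ->
  0 <= L /\ `|z t - z s| <= L * (t - s) + r.
Proof.
move=> st H; have [c _ [cL cE]] := H setT (fun _ _ _ _ _ _ _ => I) (fun _ _ _ _ => I).
split; first exact: le_trans cL.
rewrite -(subrK ((t - s) *: c) (z t - z s)) (le_trans (ler_normD _ _))// addrC lerD//.
by rewrite normrZ ger0_norm ?subr_ge0// mulrC ler_wpM2r// subr_ge0.
Qed.

(** The defect vanishes in the limit, which makes the limit locally Lipschitz. At a point of
    differentiability, the increment over a short interval is tested against an enlargement of
    [F (z t)], so the derivative is arbitrarily close to this closed set. *)
Lemma ultra_limit_DI_solution (R : realType) (d : nat) (F : 'rV[R]_d -> set 'rV[R]_d) (K : R)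
  (U : set_system nat) (z_ : nat -> R -> 'rV[R]_d) (G L : R -> R) (r : R -> nat -> R) :
  (forall x, convex_set_rV (F x) /\ compact (F x)) ->
  0 < K -> (forall u v, F u v -> `|v| <= K * (1 + `|u|)) -> closed_graph F ->
  UltraFilter U -> (forall j t, `|z_ j t| <= G t) ->
  (forall N e, 0 < e -> \forall j \near U, r N j < e) ->
  (forall N j s t, - N <= s -> s <= t -> t <= N ->
     near_inclusion F (L N) (r N j) s t (z_ j)) ->
  exists z : R -> 'rV[R]_d, [/\ forall t, (fun j => z_ j t) @ U --> z t &
    DI_solution F (z 0) z].
Proof.
move=> Fcc K0 FK clF UU zG r0 zF.
have zex t : exists l : 'rV[R]_d, (fun j => z_ j t) @ U --> l.
  exact: (@bounded_ultra_cvg R d U (fun j => z_ j t) (G t)).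
have [z zcvg] := choice zex.
have zcvg' t e : 0 < e -> \forall j \near U, `|z_ j t - z t| < e.
  by move=> e0; have /cvgrPdist_lt/(_ _ e0) := zcvg t; apply: filterS => j; rewrite distrC.
have zlip (N s t : R) : - N <= s -> s <= t -> t <= N -> `|z t - z s| <= L N * (t - s).
  move=> Ns st tN; apply/ler_addgt0Pr => e e0.
  have e3 : 0 < e / 3 by rewrite divr_gt0.
  have [j [[j1 j2] j3]] := filter_ex (filterI (filterI (zcvg' s _ e3) (zcvg' t _ e3)) (r0 N _ e3)).
  have [_ lj] := near_inclusion_lipschitz st (zF N j s t Ns st tN).
  rewrite (_ : z t - z s = - (z_ j t - z t) + (z_ j s - z s) + (z_ j t - z_ j s)); last first.
    by apply/rowP => i; rewrite !mxE; ring.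
  have := ler_normD (- (z_ j t - z t) + (z_ j s - z s)) (z_ j t - z_ j s).
  have := ler_normD (- (z_ j t - z t)) (z_ j s - z s); rewrite normrN.
  have e3E : e = e / 3 + e / 3 + e / 3 by field.
  lra.
have zlip' N : exists L, forall s t, - N <= s -> s <= t -> t <= N -> `|z t - z s| <= L * (t - s).
  by exists (L N) => s t; exact: zlip.
exists z; split=> //; split; first exact: locally_lipschitz_AC.
split=> //; have := locally_lipschitz_row_ae_derivable zlip'.
apply: filterS; first exact: (ae_filter_ringOfSetsType (@lebesgue_measure R)).
move=> t dt; split=> //.
have [Fconv Fcomp] := Fcc (z t).
have clFz : closed (F (z t)) by apply: compact_closed => //; exact: norm_hausdorff.
apply: contrapT => nF.
have /nbhs_ballP[e0 /= e00 ball_e0] : nbhs ('D_1 z t) (~` F (z t)).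
  by apply: open_nbhs_nbhs; split => //; exact: closed_openC.
(* One [e] is lost to the difference quotient and four to the approximation of the increment; the
   sixth keeps the inequality strict. *)
pose e := e0 / 6; have e_gt0 : 0 < e by rewrite divr_gt0.
suff [f Ff fE] : exists2 f, F (z t) f & `|'D_1 z t - f| <= 5 * e.
  apply: (ball_e0 f) => //; rewrite -ball_normE /=.
  by apply: (le_lt_trans fE); rewrite /e; lra.
have [del del0 usc] := closed_graph_usc clF K0 FK (z t) e_gt0.
pose N := `|t| + 1.
have Nt : - N <= t by rewrite /N; have := ler_norm (- t); rewrite normrN; lra.
have tN : t + 1 <= N by rewrite /N lerD2r ler_norm.
have tN' : t <= N by lra.
have L0 : 0 <= L N by have [] := near_inclusion_lipschitz (lexx t) (zF N 0%N t t Nt (lexx t) tN').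
have [rr rr0 Drr] : exists2 rr, 0 < rr & forall h, 0 < h -> h < rr ->
    `|'D_1 z t - h^-1 *: (z (t + h) - z t)| <= e.
  have /cvgrPdist_le/(_ _ e_gt0) :
    (fun h : R => h^-1 *: ((z \o shift t) (h *: (1 : R)) - z t)) @ 0^' --> 'D_1 z t by exact: dt.
  move=> [rr /= rr0 Hrr]; exists rr => // h h0 hrr.
  have := Hrr h; rewrite /= sub0r normrN gtr0_norm// => /(_ hrr).
  rewrite gt_eqF// => /(_ isT).
  by rewrite /shift /= (_ : h *: (1 : R) = h) ?[h + t]addrC//; exact: mulr1.
(* Three constraints on [h]: the difference quotient is accurate, [t + h] stays in the window, and
   the approximations move by less than about [del / 3] and so remain where upper semicontinuity
   applies. Halving makes them strict. *)
pose h := Num.min (Num.min rr 1) (del / (3 * (L N + 1))) / 2.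
have h0 : 0 < h.
  by rewrite divr_gt0// !lt_min rr0 ltr01/= divr_gt0// mulr_gt0// ltr_wpDl.
have hlt : h < Num.min (Num.min rr 1) (del / (3 * (L N + 1))).
  by rewrite /h in h0 *; lra.
move: hlt; rewrite !lt_min => /andP[/andP[hrr h1]].
rewrite ltr_pdivlMr ?mulr_gt0 ?ltr_wpDl// => hdel.
have hL : L N * h < del / 3.
  have : h * (3 * (L N + 1)) = 3 * (L N * h) + 3 * h by ring.
  lra.
have del3 : 0 < del / 3 by rewrite divr_gt0.
have eh0 : 0 < e * h by rewrite mulr_gt0.
(* [j] is chosen after [h]: the pointwise errors and the defect must be below [e * h], because the
   increment is finally divided by [h]. *)
have [j [[[[j1 j2] j3] j4] j5]] := filter_ex (filterI (filterI (filterI (filterI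
  (zcvg' t _ del3) (zcvg' t _ eh0)) (zcvg' (t + h) _ eh0)) (r0 N _ del3)) (r0 N _ eh0)).
have tth : t <= t + h by rewrite lerDl ltW.
have thN : t + h <= N by lra.
have [|c [f Ff cf] [_ cE]] := zF N j t (t + h) Nt tth thN _ (convex_enlargement (e := e) Fconv).
  move=> u /andP[tu uth]; apply: usc.
  have [_ lj] := near_inclusion_lipschitz tu (zF N j t u Nt tu (le_trans uth thN)).
  have := ler_normD (z_ j u - z_ j t) (z_ j t - z t); rewrite subrKA.
  have : L N * (u - t) <= L N * h by rewrite ler_wpM2l// lerBlDl.
  have dE : del = del / 3 + del / 3 + del / 3 by field.
  lra.
exists f => //.
have fE : `|z (t + h) - z t - h *: f| <= 4 * e * h.
  rewrite (_ : _ - _ - _ = - (z_ j (t + h) - z (t + h)) + (z_ j t - z t) +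
    (z_ j (t + h) - z_ j t - (t + h - t) *: c) + h *: (c - f)); last first.
    by apply/rowP => i; rewrite !mxE; ring.
  have := ler_normD (- (z_ j (t + h) - z (t + h)) + (z_ j t - z t) +
    (z_ j (t + h) - z_ j t - (t + h - t) *: c)) (h *: (c - f)).
  have := ler_normD (- (z_ j (t + h) - z (t + h)) + (z_ j t - z t))
    (z_ j (t + h) - z_ j t - (t + h - t) *: c).
  have := ler_normD (- (z_ j (t + h) - z (t + h))) (z_ j t - z t).
  rewrite normrN normrZ gtr0_norm//.
  have := ler_wpM2l (ltW h0) cf.
  have -> : 4 * e * h = e * h + e * h + e * h + e * h by ring.
  rewrite [h * e]mulrC; lra.
have fE' : `|h^-1 *: (z (t + h) - z t) - f| <= 4 * e.
  rewrite (_ : _ - _ = h^-1 *: (z (t + h) - z t - h *: f)); last first.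
    by rewrite [RHS]scalerBr scalerA mulVf ?gt_eqF// scale1r.
  by rewrite normrZ gtr0_norm ?invr_gt0// mulrC ler_pdivrMr.
have := Drr h h0 hrr.
have := ler_normD ('D_1 z t - h^-1 *: (z (t + h) - z t)) (h^-1 *: (z (t + h) - z t) - f).
rewrite subrKA; lra.
Qed.

(** [T] is an attraction time for [e / 2] and depends on [e] only, whereas [rho] depends on the
    horizon [T'], since approximate solutions are controlled on bounded windows only.
    Counterexamples with [rho] tending to 0 would have as limit a solution that violates attraction;
    compactness of [C0] keeps its starting point in [O]. *)
Lemma path_tracking (R : realType) (d : nat) (F : 'rV[R]_d -> set 'rV[R]_d) (K : R)
  (A O C0 : set 'rV[R]_d) :
  (forall x, F x !=set0 /\ convex_set_rV (F x) /\ compact (F x)) ->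
  0 < K -> (forall u v, F u v -> `|v| <= K * (1 + `|u|)) -> closed_graph F ->
  attracting_set_with F A O -> compact C0 -> C0 `<=` O ->
  forall e, 0 < e -> exists2 T : R, 0 < T & forall T' : R, exists2 rho : R, 0 < rho <= 1 &
    forall (a : nat -> R) (x S : nat -> 'rV[R]_d),
      (forall k, 0 < a k) -> (forall C, exists k, C < path_time a k) ->
      (forall k, a k <= rho) -> DI_path F a x S ->
      (forall j k, `|S j - S k| <= rho) -> C0 (x 0%N) ->
      forall k, T <= path_time a k <= T' -> eps_nbhd A e (x k).
Proof.
move=> FA K0 FK clF [_ [_ [_ att]]] cC0 C0O e e0.
have e20 : 0 < e / 2 by rewrite divr_gt0.
have [T T0 attT] := att _ e20; exists T => // T'.
apply: contrapT => /forall2NP H.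
have [B BP] : exists B, forall y, C0 y -> `|y| <= B.
  have [B [_ HB]] := compact_bounded cC0.
  by exists (B + 1) => y C0y; apply: HB => //; rewrite ltrDl.
have bad (j : nat) : exists p : (nat -> R) * (nat -> 'rV[R]_d) * (nat -> 'rV[R]_d) * nat,
    let: (a, x, s, k) := p in
    [/\ (forall k, 0 < a k), (forall C, exists k, C < path_time a k) &
      (forall k, a k <= j.+1%:R^-1)] /\
    [/\ DI_path F a x s, (forall i k, `|s i - s k| <= j.+1%:R^-1), C0 (x 0%N),
      T <= path_time a k <= T' & ~ eps_nbhd A e (x k)].
  have [|] := H j.+1%:R^-1; first by rewrite invr_gt0 ltr0n /= invf_le1 ?ler1n.
  move=> /existsNP[a /existsNP[x /existsNP[S]]].
  move=> /not_implyP[a0 /not_implyP[div /not_implyP[aj /not_implyP[xS /not_implyP[Sj]]]]].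
  move=> /not_implyP[Cx /existsNP[k /not_implyP[tk nA]]].
  by exists (a, x, S, k); split.
have [p pP] := choice bad.
pose a_ j := (p j).1.1.1; pose x_ j := (p j).1.1.2; pose S_ j := (p j).1.2; pose k_ j := (p j).2.
pose L N := K * ((2 + B) * expR (K * N)).
pose r N (j : nat) : R := 2 * (j.+1%:R^-1 * L N + j.+1%:R^-1).
have {}bad j : [/\ (forall k, 0 < a_ j k), (forall C, exists k, C < path_time (a_ j) k) &
      (forall k, a_ j k <= j.+1%:R^-1)] /\
    [/\ DI_path F (a_ j) (x_ j) (S_ j), (forall i k, `|S_ j i - S_ j k| <= j.+1%:R^-1),
      C0 (x_ j 0%N), T <= path_time (a_ j) (k_ j) <= T' & ~ eps_nbhd A e (x_ j (k_ j))].
  by rewrite /a_ /x_ /S_ /k_; move: (pP j); case: (p j) => [[[? ?] ?] ?].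
have zex j : exists z : R -> 'rV[R]_d,
    [/\ forall k, z (path_time (a_ j) k) = x_ j k,
        forall t, 1 + `|z t| <= (2 + B) * expR (K * `|t|) &
        forall N s t, - N <= s -> s <= t -> t <= N -> near_inclusion F (L N) (r N j) s t z].
  have [[a0 div aj] [xS Sj Cx _ _]] := bad j.
  apply: (path_interpolation_line (fun u => (FA u).1) K0 FK a0 div aj xS Sj _ (BP _ Cx)).
  by rewrite invf_le1 ?ler1n.
have [z_ zP] := choice zex.
have [U [UU ooU]] := @ultraFilterLemma nat \oo _.
have inv_small (c q : R) : 0 < q -> \forall j \near U, c * j.+1%:R^-1 < q.
  move=> q0; apply: ooU.
  have : (fun k : nat => c * k.+1%:R^-1 : R) @ \oo --> c * (0 : R).
    by apply: cvgMr; exact: cvg_harmonic.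
  rewrite mulr0 => /cvgrPdist_lt/(_ _ q0); apply: filterS => k /=.
  by rewrite sub0r normrN; apply: le_lt_trans; exact: ler_norm.
have r0 N q : 0 < q -> \forall j \near U, r N j < q.
  move=> q0; have := inv_small (2 * (L N + 1)) q q0; apply: filterS => j.
  by rewrite /r; apply: le_lt_trans; rewrite le_eqVlt; apply/orP; left; apply/eqP; ring.
have [||z [zcvg zsol]] := @ultra_limit_DI_solution R d F K U z_
    (fun t => (2 + B) * expR (K * `|t|)) L r (fun x => (FA x).2) K0 FK clF UU _ r0.
- by move=> j t; have [_ H1 _] := zP j; rewrite (le_trans _ (H1 t))// lerDr.
- by move=> N j; have [_ _ ] := zP j; exact.
have [tau [/= tauT tcvg]] := @compact_ultra_cvg R U `[T, T']%classic
  (fun j => path_time (a_ j) (k_ j)) UU (@segment_compact _ _ _)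
  (fun j => let: conj _ (And5 _ _ _ h _) := bad j in h).
have [p0 [C0p p0cvg]] := @compact_ultra_cvg _ U C0 (fun j => x_ j 0%N) UU cC0
  (fun j => let: conj _ (And5 _ _ h _ _) := bad j in h).
have z0E : z 0 = p0.
  have zx0 : (fun j => x_ j 0%N) = (fun j => z_ j 0).
    apply/funext => j; have [/(_ 0%N) + _ _] := zP j.
    by rewrite /path_time big_geq.
  rewrite zx0 in p0cvg.
  exact: (cvg_unique (@norm_hausdorff _ _) (zcvg 0) p0cvg).
move: tauT; rewrite in_itv/= => /andP[Ttau tauT'].
have [q Aq qE] : eps_nbhd A (e / 2) (z tau).
  apply: (attT tau (z 0)) => //; first by apply: C0O; rewrite z0E.
  by exists z.
(* Attraction gives [e / 2] at [tau]; pointwise convergence, the move from [tau] to the hitting time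
   [tj], and the defect cost [e / 8] each. *)
have e80 : 0 < e / 8 by rewrite divr_gt0.
have L0 : 0 <= L T'.
  have [_ _ zF] := zP 0%N.
  have T'0 : 0 <= T' by rewrite (le_trans (ltW T0))// (le_trans Ttau).
  by have [] := near_inclusion_lipschitz (lexx 0) (zF T' 0 0 _ (lexx 0) _); rewrite ?oppr_le0.
have near1 : \forall j \near U, `|z_ j tau - z tau| < e / 8.
  by have /cvgrPdist_lt/(_ _ e80) := zcvg tau; apply: filterS => j; rewrite distrC.
have near2 : \forall j \near U, `|path_time (a_ j) (k_ j) - tau| < (e / 8) / (L T' + 1).
  have q0 : 0 < (e / 8) / (L T' + 1) by rewrite divr_gt0// ltr_wpDl.
  by move/cvgrPdist_lt : tcvg => /(_ _ q0); apply: filterS => j; rewrite distrC.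
have [j [[j1 j2] j3]] := filter_ex (filterI (filterI near1 near2) (r0 T' _ e80)).
have [_ [_ _ _ /andP[Tt tT'] nA]] := bad j.
apply: nA; exists q => //.
have [zx _ zF] := zP j; rewrite -zx; set tj := path_time _ _ in j2 Tt tT' *.
have jl : `|z_ j tj - z_ j tau| <= L T' * `|tj - tau| + r T' j.
  have N0 : - T' <= 0 by rewrite oppr_le0 (le_trans (ltW T0))// (le_trans Ttau).
  have [st|/ltW st] := leP tj tau.
    have [] := near_inclusion_lipschitz st (zF T' tj tau _ st tauT').
      by rewrite (le_trans N0)// (le_trans (ltW T0)).
    by move=> _; rewrite distrC [`|tj - tau|]distrC [`|tau - tj|]ger0_norm ?subr_ge0.
  have [] := near_inclusion_lipschitz st (zF T' tau tj _ st tT').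
    by rewrite (le_trans N0)// (le_trans (ltW T0)).
  by move=> _; rewrite [`|tj - tau|]ger0_norm ?subr_ge0.
have jL : L T' * `|tj - tau| <= e / 8.
  apply: (@le_trans _ _ ((L T' + 1) * `|tj - tau|)).
    by rewrite ler_wpM2r// lerDl.
  by rewrite mulrC -ler_pdivlMr ?ltr_wpDl// ltW.
have := ler_normD (z_ j tj - z_ j tau) (z_ j tau - q); rewrite subrKA.
have := ler_normD (z_ j tau - z tau) (z tau - q); rewrite subrKA.
lra.
Qed.

(** * Lock-in and convergence for small noise *)

Lemma compact_eps_nbhd_sub (R : realType) (d : nat) (A O : set 'rV[R]_d) :
  compact A -> open O -> A `<=` O -> exists2 e : R, 0 < e & eps_nbhd A e `<=` O.
Proof.
move=> cA oO AO; apply: contrapT => /forall2NP H.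
have bad (j : nat) : exists p : 'rV[R]_d * 'rV[R]_d,
    [/\ A p.1, `|p.2 - p.1| < j.+1%:R^-1 & ~ O p.2].
  have [|] := H j.+1%:R^-1; first by rewrite invr_gt0 ltr0n.
  move=> /existsNP[y /not_implyP[[c Ac yc] nOy]]; by exists (c, y).
have [p pP] := choice bad.
have [U [UU ooU]] := @ultraFilterLemma nat \oo _.
have [c [Ac ccvg]] := @compact_ultra_cvg _ U A (fun j => (p j).1) UU cA
  (fun j => let: And3 h _ _ := pP j in h).
have /nbhs_ballP[e /= e0 ce] : nbhs c O.
  by apply: open_nbhs_nbhs; split => //; exact: AO.
have e20 : 0 < e / 2 by rewrite divr_gt0.
have near1 : \forall j \near U, `|c - (p j).1| < e / 2.
  by have /cvgrPdist_lt/(_ _ e20) := ccvg.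
have near2 : \forall j \near U, j.+1%:R^-1 < e / 2.
  apply: ooU; have /cvgrPdist_lt/(_ _ e20) := @cvg_harmonic R; apply: filterS => j.
  by rewrite sub0r normrN; apply: le_lt_trans; exact: ler_norm.
have [j [j1 j2]] := filter_ex (filterI near1 near2).
have [_ j3 nO] := pP j; apply: nO; apply: ce; rewrite -ball_normE /=.
have := ler_normD (c - (p j).1) ((p j).1 - (p j).2); rewrite subrKA [`|(p j).1 - _|]distrC.
have eE : e = e / 2 + e / 2 by field.
have j4 := lt_trans j3 j2; lra.
Qed.

Lemma path_time_shift (R : realType) (a : nat -> R) (n k : nat) :
  path_time (fun i => a (n + i)%N) k = path_time a (n + k) - path_time a n.
Proof.
elim: k => [|k IH]; first by rewrite addn0 subrr /path_time big_geq.
rewrite addnS {1}/path_time big_nat_recr//= -/(path_time _ k) IH.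
by rewrite /path_time [in RHS]big_nat_recr//=; ring.
Qed.

Lemma DI_path_shift (R : realType) (d : nat) (F : 'rV[R]_d -> set 'rV[R]_d) a x S n :
  DI_path F a x S ->
  DI_path F (fun i => a (n + i)%N) (fun i => x (n + i)%N) (fun i => S (n + i)%N).
Proof. by move=> xS k; have := xS (n + k)%N; rewrite addnS. Qed.

Lemma path_time_shift_unbounded (R : realType) (a : nat -> R) n : (forall k, 0 < a k) ->
  (forall C, exists k, C < path_time a k) ->
  forall C, exists k, C < path_time (fun i => a (n + i)%N) k.
Proof.
move=> a0 div C; have [k kC] := div (C + path_time a n); exists k.
rewrite path_time_shift ltrBrDr (lt_le_trans kC)// path_time_mono//.
exact: leq_addl.
Qed.

(** The window from [T1] to [T1 + 1] is longer than any step, so the path cannot jump over it and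
    returns to [O'] there. Between returns Gronwall bounds the states, and each return is a new
    starting point for tracking with a finer tolerance. *)
Lemma lock_in (R : realType) (d : nat) (F : 'rV[R]_d -> set 'rV[R]_d) (K : R)
  (A O O' : set 'rV[R]_d) :
  (forall x, F x !=set0 /\ convex_set_rV (F x) /\ compact (F x)) ->
  0 < K -> (forall u v, F u v -> `|v| <= K * (1 + `|u|)) -> closed_graph F ->
  attracting_set_with F A O ->
  open O' -> A `<=` O' -> compact (closure O') -> closure O' `<=` O ->
  exists2 rho : R, 0 < rho <= 1 & exists C : R,
    forall (a : nat -> R) (x S : nat -> 'rV[R]_d),
      (forall k, 0 < a k) -> (forall B, exists k, B < path_time a k) ->
      (forall k, a k <= rho) -> DI_path F a x S ->
      (forall j k, `|S j - S k| <= rho) -> O' (x 0%N) ->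
      (forall k, `|x k| <= C) /\
      ((forall e, 0 < e -> exists N, forall j k, (N <= j)%N -> (N <= k)%N ->
          a k <= e /\ `|S j - S k| <= e) ->
       forall e, 0 < e -> exists N, forall k, (N <= k)%N -> eps_nbhd A e (x k)).
Proof.
move=> FA K0 FK clF attA oO' AO' cO' O'O.
have track := path_tracking FA K0 FK clF attA cO' O'O.
have [e1 e10 AeO'] := compact_eps_nbhd_sub attA.1 oO' AO'.
have [T1 T10 HT1] := track _ e10.
have [rho /andP[rho0 rho1] Hrho] := HT1 (T1 + 1).
have [B BP] : exists B, forall y, O' y -> `|y| <= B.
  have [B [_ HB]] := compact_bounded cO'.
  by exists (B + 1) => y O'y; apply: HB; [rewrite ltrDl|exact: subset_closure].
exists rho; first by rewrite rho0.
exists ((2 + B) * expR (K * (T1 + 1))) => a x S a0 div arho xS Srho O'x0.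
have tmono := path_time_mono a0.
have tS k : path_time a k.+1 = path_time a k + a k by rewrite /path_time big_nat_recr.
(* The last recorded visit is at most [T1 + 1] old. When the next step would make it older, the
   present time is already at least [T1] after it, so the present state is in [O'] and becomes the
   new record. *)
have recur k : exists2 n, (n <= k)%N & O' (x n) /\ path_time a k - path_time a n <= T1 + 1.
  elim: k => [|k [n nk [ O'n tn]]]; first by exists 0%N => //; split; rewrite // subrr; lra.
  have [ltT|gtT] := leP (path_time a k.+1 - path_time a n) (T1 + 1).
    by exists n => //; rewrite ltnW.
  exists k => //; split; last by rewrite tS; have := arho k; lra.
  apply: AeO'; rewrite -(subnKC nk).
  apply: (Hrho _ _ _ _ _ _ (DI_path_shift n xS)) => //.
  - exact: path_time_shift_unbounded.
  - by rewrite addn0; exact: subset_closure.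
  rewrite path_time_shift subnKC// tn andbT.
  by move: gtT; rewrite tS; have := arho k; lra.
split=> [k|small e e0].
  have [n nk [ O'n tn]] := recur k.
  have B0 : 0 <= B by rewrite (le_trans _ (BP _ O'n)).
  have := path_gronwall (B := B) K0 FK (fun i => a0 (n + i)%N) (DI_path_shift n xS) _ _ (k - n)%N.
  rewrite path_time_shift subnKC// addn0 => G.
  apply: (@le_trans _ _ ((2 + B) * expR (K * (path_time a k - path_time a n)))).
    apply: le_trans (G _ _); first by rewrite lerDr.
      by move=> i; rewrite (le_trans (Srho _ _)).
    exact: BP.
  by rewrite ler_wpM2l ?addr_ge0// ler_expR ler_pM2l.
have [Te Te0 HTe] := track _ e0.
(* Going back [Te] from the time of [k], then to the grid (at most 1), then to the last visit (at
   most [T1 + 1]), gives a visit between [Te] and [Te + T1 + 2] earlier. The same margin in the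
   choice of [k0] puts this visit after [N]. *)
have [rhoe /andP[rhoe0 rhoe1] Hrhoe] := HTe (Te + T1 + 2).
have [N HN] := small _ rhoe0.
have [k0 k0P] := div (path_time a N + Te + T1 + 2).
exists k0 => k kk0.
have tk : path_time a N + Te + T1 + 2 < path_time a k by rewrite (lt_le_trans k0P)// tmono.
have tN0 : 0 <= path_time a N by rewrite sumr_ge0// => i _; exact: ltW.
have [kappa kappaP] := path_time_interval a0 div.
have tkTe : 0 <= path_time a k - Te by lra.
have /andP[k'1 k'2] := kappaP _ tkTe; set k' := kappa _ in k'1 k'2.
have [n nk' [ O'n tn]] := recur k'.
move: k'2; rewrite tS => k'2; have ak' := arho k'.
have tnk : path_time a n <= path_time a k' by rewrite tmono.
have Nn : (N <= n)%N by rewrite -tmono; lra.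
have nk : (n <= k)%N by rewrite -tmono; lra.
rewrite -(subnKC nk).
apply: (Hrhoe _ _ _ _ _ _ (DI_path_shift n xS)) => //.
- exact: path_time_shift_unbounded.
- by move=> i; apply: (HN (n + i)%N (n + i)%N _ _).1; rewrite (leq_trans Nn)// leq_addr.
- by move=> i j; apply: (HN (n + i)%N (n + j)%N _ _).2; rewrite (leq_trans Nn)// leq_addr.
- by rewrite addn0; exact: subset_closure.
by rewrite path_time_shift subnKC//; lra.
Qed.

(** Lock-in is about infinite paths with small noise throughout. A path known to be good only up to
    [m] is made so by freezing its noise there. *)
Lemma DI_path_extend (R : realType) (d : nat) (F : 'rV[R]_d -> set 'rV[R]_d)
  (a : nat -> R) (x S : nat -> 'rV[R]_d) (m : nat) : (forall u, F u !=set0) ->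
  (forall k, (k < m)%N -> exists2 y, F (x k) y & x k.+1 = x k + a k *: y + (S k.+1 - S k)) ->
  exists2 x' : nat -> 'rV[R]_d, forall k, (k <= m)%N -> x' k = x k &
    DI_path F a x' (fun k => S (minn k m)).
Proof.
move=> F0 xS; have [w w0 wP] := DI_path_exists (fun i => a (m + i)%N) (x m) F0.
exists (fun k => if (k <= m)%N then x k else w (k - m)%N) => [k ->//|k].
have [km|mk] := ltnP k m.
  by rewrite (ltnW km) (minn_idPl km); exact: xS.
have -> : (if (k <= m)%N then x k else w (k - m)%N) = w (k - m)%N.
  case: ifP => // km; have -> : k = m by apply/eqP; rewrite eqn_leq km.
  by rewrite subnn w0.
have [y Fy yE] := wP (k - m)%N; exists y => //.
rewrite (minn_idPr (leqW mk)) subSn// yE subnKC//.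
by rewrite !subrr.
Qed.

(** * A tail bound for martingales *)

(** For [u] above one half, [u] is below [2 * u ^+ 2]. Otherwise bound [expR u] by the inverse of
    [1 - u], then by [1 + u + 2 * u ^+ 2]. The linear term is kept apart because it has zero mean
    for a martingale increment. *)
Lemma expR_le_linear_gauss (R : realType) (u : R) : expR u <= u + expR (2 * u ^+ 2).
Proof.
have [u2|u2] := leP u (2^-1); last first.
  have : expR u <= expR (2 * u ^+ 2).
    rewrite ler_expR expr2; have : 2^-1 * u <= u * u by rewrite ler_wpM2r; lra.
    lra.
  lra.
have q := expR_ge1Dx (2 * u ^+ 2).
suff : expR u <= 1 + u + 2 * u ^+ 2 by lra.
have e0 := expR_gt0 (- u); have e1 := expR_ge1Dx (- u).
rewrite -[leLHS]invrK -expRN -[leLHS]mul1r ler_pdivrMr//.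
have p0 : 0 <= 1 + u + 2 * u ^+ 2.
  have -> : 1 + u + 2 * u ^+ 2 = (u + 2^-1) ^+ 2 + u ^+ 2 + 3/4 by field.
  by rewrite !addr_ge0 ?sqr_ge0// divr_ge0.
apply: le_trans (ler_wpM2l p0 e1).
have -> : (1 + u + 2 * u ^+ 2) * (1 + - u) = 1 + u ^+ 2 * (1 - 2 * u) by ring.
by rewrite lerDl mulr_ge0 ?sqr_ge0//; lra.
Qed.

Lemma sub_sigma_measurable_fun (dT : measure_display) (T : measurableType dT) (R : realType)
  (G : set (set T)) (h : T -> R) : <<s G>> `<=` measurable ->
  measurable_fun [set: g_sigma_algebraType G] h -> measurable_fun [set: T] h.
Proof. by move=> Gm mh _ B mB; apply: Gm; exact: mh. Qed.

Lemma sub_sigma_measurable_funS (T : pointedType) (R : realType)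
  (G G' : set (set T)) (h : T -> R) : <<s G>> `<=` <<s G'>> ->
  measurable_fun [set: g_sigma_algebraType G] h -> measurable_fun [set: g_sigma_algebraType G'] h.
Proof. by move=> GG' mh _ B mB; apply: GG'; exact: mh. Qed.

Lemma bounded_measurable_integrable (dT : measure_display) (T : measurableType dT) (R : realType)
  (P : probability T R) (A : set T) (f : T -> R) (C : R) :
  measurable A -> measurable_fun setT f -> (forall w, `|f w| <= C) ->
  P.-integrable A (EFin \o f).
Proof.
move=> mA mf fC; apply: measurable_bounded_integrable => //.
- exact: (le_lt_trans (probability_le1 P mA) (ltry 1)).
- exact: measurable_funTS.
- by exists C; split; [exact: num_real|move=> M CM w _ /=; rewrite (le_trans (fC w))// ltW].
Qed.

(** The pull-out property of conditional expectation, phrased with integrals over events of the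
    smaller sigma-algebra: simple functions first, then dominated convergence. *)
Lemma integral_sub_sigma_orthogonal (dT : measure_display) (T : measurableType dT) (R : realType)
  (P : probability T R) (G : set (set T)) (D h : T -> R) (c C : R) (E : set T) :
  <<s G>> `<=` measurable -> measurable_fun setT D -> (forall w, `|D w| <= c) ->
  (forall B, <<s G>> B -> (\int[P]_(w in B) (D w)%:E = 0)%E) ->
  measurable_fun [set: g_sigma_algebraType G] h -> (forall w, 0 <= h w <= C) ->
  <<s G>> E -> (\int[P]_(w in E) (h w * D w)%:E = 0)%E.
Proof.
move=> Gm mD Dc D0 mh hC sE.
have mE : measurable E by exact: Gm.
have c0 : 0 <= c by rewrite (le_trans _ (Dc point)).
pose h' : g_sigma_algebraType G -> R := h.
have mh' : measurable_fun [set: g_sigma_algebraType G] (EFin \o h') by exact/measurable_EFinP.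
(* The approximation is taken in the smaller sigma-algebra, so that the level sets of the simple
   functions belong to it. *)
pose g := nnsfun_approx (@measurableT _ (g_sigma_algebraType G)) mh'.
pose gf (n : nat) : g_sigma_algebraType G -> R := g n.
have gh (w : T) : (fun n => gf n w) @ \oo --> h w.
  have h'0 x : setT x -> (0 <= (EFin \o h') x)%E.
    by move=> _ /=; rewrite lee_fin; have /andP[] := hC x.
  by have /fine_cvgP[_] := cvg_nnsfun_approx measurableT mh' h'0 (x := w) I.
have gle n (w : T) : 0 <= gf n w <= C.
  apply/andP; split; first exact: fun_ge0.
  have /andP[_ h2] := hC w; apply: le_trans h2.
  rewrite -lee_fin /gf /g nnsfun_approxE.
  apply: (le_approx n (D := setT) (f := EFin \o h')) => // x _ /=.
  by rewrite lee_fin; have /andP[] := hC x.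
have mgf n : measurable_fun [set: g_sigma_algebraType G] (gf n).
  exact: measurable_funPT.
have mg n : measurable_fun [set: T] (gf n : T -> R).
  exact: (sub_sigma_measurable_fun Gm (mgf n)).
have int0 n : (\int[P]_(w in E) (gf n w * D w)%:E = 0)%E.
  pose s : seq R := finmap.enum_fset (fset_set (gf n @` setT)).
  pose B i : set T := gf n @^-1` [set s`_i].
  transitivity (\int[P]_(w in E) (\sum_(i < size s) (s`_i * (\1_(B i) w * D w))%:E))%E.
    apply: eq_integral => w _; rewrite sumEFin; congr (_%:E).
    rewrite /gf [in LHS](fimfunEord (g n)) mulr_suml; apply: eq_bigr => i _.
    by rewrite mulrA.
  have sB i : <<s G>> (B i).
    by have := mgf n measurableT [set s`_i] (measurable_set1 _); rewrite setTI.
  have ii i : P.-integrable E (EFin \o (fun w => \1_(B i) w * D w)).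
    apply: (@bounded_measurable_integrable _ _ _ _ _ _ c) => //.
      by apply: measurable_funM => //; apply: measurable_indic; exact: Gm.
    by move=> w; rewrite normrM indicE; case: (_ \in _); rewrite ?normr1 ?mul1r ?normr0 ?mul0r.
  rewrite integral_sum//; last first.
    move=> i; rewrite (_ : (fun _ => _) = (fun w => ((s`_i)%:E * (EFin \o (fun w => \1_(B i) w * D w)%R) w)%E))//.
    exact: integrableZl.
  rewrite big1// => i _.
  under eq_integral do rewrite EFinM.
  rewrite integralZl//; last exact: ii.
  rewrite (_ : (\int[P]_(w in E) (\1_(B i) w * D w)%:E)%E =
     (\int[P]_(w in E `&` B i) (D w)%:E)%E).
    rewrite D0 ?mule0//.
    exact (@measurableI _ (g_sigma_algebraType G) E (B i) sE (sB i)).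
  rewrite integral_mkcondr; apply: eq_integral => w _.
  by rewrite patchE indicE; case: (w \in B i); rewrite ?mul1r ?mul0r.
have [|||||_ _] := @dominated_convergence _ T R P E mE (fun n w => (gf n w * D w)%:E)
   (fun w => (h w * D w)%:E) (cst (C * c)%:E).
- by move=> n; apply/measurable_EFinP/measurable_funTS/measurable_funM.
- apply/measurable_EFinP/measurable_funTS/measurable_funM => //.
  exact: sub_sigma_measurable_fun mh.
- apply: aeW => w _; apply/cvg_EFin; first by apply: nearW.
  by apply: cvgMl; exact: gh.
- apply: (@bounded_measurable_integrable _ _ _ _ _ _ `|C * c|) => //.
- apply: aeW => w n _ /=; rewrite lee_fin normrM; have /andP[g0 gC] := gle n w.
  by rewrite (ger0_norm g0) ler_pM.
rewrite (_ : [sequence _]_n = cst 0%E); last by apply/funext => n /=; exact: int0.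
by move=> H; apply/esym; apply: (cvg_unique _ (cvg_cst 0%E) H).
Qed.

Definition increment_sum (R : realType) (T : Type) (D : nat -> T -> R) (m n : nat) (w : T) : R :=
  \sum_(m <= k < n) D k w.

Lemma measurable_increment_sum (dT : measure_display) (T : measurableType dT) (R : realType)
  (D : nat -> T -> R) (m n : nat) :
  (forall k, (m <= k < n)%N -> measurable_fun setT (D k)) ->
  measurable_fun setT (increment_sum D m n).
Proof.
elim: n => [|n IH] mD.
  rewrite (_ : increment_sum D m 0 = cst 0)//.
  by apply/funext => w; rewrite /increment_sum big_geq.
have [nm|mn] := ltnP n m.
  rewrite (_ : increment_sum D m n.+1 = cst 0)//.
  by apply/funext => w; rewrite /increment_sum big_geq.
rewrite (_ : increment_sum D m n.+1 = increment_sum D m n \+ D n).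
  apply: measurable_funD; last by apply: mD; rewrite mn leqnn.
  by apply: IH => k /andP[mk kn]; apply: mD; rewrite mk ltnW.
by apply/funext => w; rewrite /increment_sum big_nat_recr.
Qed.

Lemma azuma_mgf (dT : measure_display) (T : measurableType dT) (R : realType)
  (P : probability T R) (G : nat -> set (set T)) (D : nat -> T -> R) (c : nat -> R)
  (lam : R) (m : nat) (E : set T) :
  (forall n, <<s G n>> `<=` measurable) ->
  (forall n, <<s G n>> `<=` <<s G n.+1>>) ->
  (forall n, measurable_fun [set: g_sigma_algebraType (G n.+1)] (D n)) ->
  (forall n w, `|D n w| <= c n) ->
  (forall n B, <<s G n>> B -> (\int[P]_(w in B) (D n w)%:E = 0)%E) ->
  <<s G m>> E ->
  forall n, (m <= n)%N ->
    (\int[P]_(w in E) (expR (lam * increment_sum D m n w))%:E <=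
     (expR (2 * lam ^+ 2 * \sum_(m <= k < n) c k ^+ 2))%:E * P E)%E.
Proof.
move=> Gm GS mD Dc D0 sE.
have GSmn m' n' : (m' <= n')%N -> <<s G m'>> `<=` <<s G n'>>.
  by move=> /subnK <-; elim: (n' - m')%N => // k IH; apply: subset_trans IH (GS _).
have mE : measurable E by exact: Gm sE.
have mD' k : measurable_fun setT (D k) := sub_sigma_measurable_fun (Gm k.+1) (mD k).
have mS n : (m <= n)%N -> measurable_fun [set: g_sigma_algebraType (G n)]
    (fun w : g_sigma_algebraType (G n) => expR (lam * increment_sum D m n w)).
  move=> mn; apply: measurableT_comp => //; apply: measurable_funM => //.
  apply: (@measurable_increment_sum _ (g_sigma_algebraType (G n)) R D m n).
  by move=> k /andP[_ kn]; apply: (sub_sigma_measurable_funS (GSmn _ _ kn)); exact: mD.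
elim=> [|n IH].
  rewrite leqn0 => /eqP m0; subst m.
  under eq_integral do rewrite /increment_sum big_geq// mulr0 expR0.
  by rewrite integral_cst// !big_geq// mulr0 expR0.
rewrite leq_eqVlt => /predU1P[<-|].
  under eq_integral do rewrite /increment_sum big_geq// mulr0 expR0.
  by rewrite integral_cst// big_geq// mulr0 expR0.
rewrite ltnS => mn; have {}IH := IH mn.
pose h w := expR (lam * increment_sum D m n w).
pose C := expR (`|lam| * \sum_(m <= k < n) c k).
have SE w : increment_sum D m n.+1 w = increment_sum D m n w + D n w.
  by rewrite /increment_sum big_nat_recr.
have hC w : 0 <= h w <= C.
  rewrite expR_ge0/= ler_expR (le_trans (ler_norm _))// normrM ler_wpM2l//.
  by rewrite (le_trans (ler_norm_sum _ _ _))// ler_sum.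
have cn0 : 0 <= c n by rewrite (le_trans _ (Dc n point)).
have mh : measurable_fun setT h := sub_sigma_measurable_fun (Gm n) (mS n mn).
have hn w : `|h w| <= C by have /andP[? ?] := hC w; rewrite ger0_norm.
have orth : (\int[P]_(w in E) (h w * D n w)%:E = 0)%E.
  apply: (integral_sub_sigma_orthogonal (c := c n) (Gm n) (mD' n) (Dc n) (D0 n) (mS n mn) hC).
  exact: GSmn sE.
pose q := expR (2 * lam ^+ 2 * c n ^+ 2).
have ih : P.-integrable E (EFin \o h) by exact: (bounded_measurable_integrable _ mE mh hn).
have ihD : P.-integrable E (EFin \o (h \* D n)).
  apply: (@bounded_measurable_integrable _ _ _ _ _ _ (C * c n)) => //.
    exact: measurable_funM.
  by move=> w; rewrite normrM ler_pM.
(* The first term on the right integrates to zero by orthogonality; the second yields the induction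
   step with the factor [q]. *)
have ineq w : expR (lam * increment_sum D m n.+1 w) <= lam * (h w * D n w) + q * h w.
  rewrite SE mulrDr expRD -/(h w).
  have := expR_le_linear_gauss (lam * D n w).
  have q1 : expR (2 * (lam * D n w) ^+ 2) <= q.
    rewrite ler_expR -mulrA ler_pM2l// exprMn ler_wpM2l ?sqr_ge0//.
    by rewrite -(real_normK (num_real (D n w))) ler_sqr ?nnegrE.
  have /andP[h0 _] := hC w => H.
  have := ler_wpM2l h0 (le_trans H (lerD (lexx _) q1)); lra.
apply: (@le_trans _ _ (\int[P]_(w in E) (lam%:E * (h w * D n w)%:E + q%:E * (h w)%:E))%E).
  apply: ge0_le_integral => //.
  - by apply/measurable_EFinP/measurable_funTS/(sub_sigma_measurable_fun (Gm n.+1)); apply: mS; exact: leqW.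
  - apply: emeasurable_funD; apply: measurable_funeM.
      by apply/measurable_EFinP/measurable_funTS/measurable_funM.
    by apply/measurable_EFinP/measurable_funTS.
  - by move=> w _; rewrite -!EFinM -EFinD lee_fin.
rewrite integralD//; [|exact: integrableZl..].
rewrite integralZl// integralZl// orth mule0 add0e.
rewrite big_nat_recr//= mulrDr expRD [(_ * expR _)%R]mulrC EFinM -muleA lee_pmul2l//.
by rewrite lte_fin expR_gt0.
Qed.

Lemma azuma_tail (dT : measure_display) (T : measurableType dT) (R : realType)
  (P : probability T R) (G : nat -> set (set T)) (D : nat -> T -> R) (c : nat -> R)
  (m : nat) (E : set T) (V e : R) :
  (forall n, <<s G n>> `<=` measurable) ->
  (forall n, <<s G n>> `<=` <<s G n.+1>>) ->
  (forall n, measurable_fun [set: g_sigma_algebraType (G n.+1)] (D n)) ->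
  (forall n w, `|D n w| <= c n) ->
  (forall n B, <<s G n>> B -> (\int[P]_(w in B) (D n w)%:E = 0)%E) ->
  <<s G m>> E -> 0 < e -> 0 < V ->
  forall n, (m <= n)%N -> \sum_(m <= k < n) c k ^+ 2 <= V ->
    (P (E `&` [set w | (e <= increment_sum D m n w)%R]) <=
     (expR (- (e ^+ 2 / (8 * V))))%:E * P E)%E.
Proof.
move=> Gm GS mD Dc D0 sE e0 V0 n mn cV.
have mE : measurable E by exact: Gm sE.
(* This minimizes the Chernoff exponent [2 * lam ^+ 2 * V - lam * e]. *)
pose lam := e / (4 * V).
have lam0 : 0 < lam by rewrite divr_gt0// mulr_gt0.
have mS : measurable_fun setT (increment_sum D m n).
  by apply: measurable_increment_sum => k _; exact: (sub_sigma_measurable_fun (Gm k.+1) (mD k)).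
have mB : measurable [set w | (e <= increment_sum D m n w)%R].
  have -> : [set w | (e <= increment_sum D m n w)%R] = increment_sum D m n @^-1` `[e, +oo[%classic.
    by apply/seteqP; split => w /=; rewrite in_itv/= andbT.
  by rewrite -[X in measurable X]setTI; apply: mS.
have mEB := measurableI _ _ mE mB.
have mexp : measurable_fun setT (fun w => expR (lam * increment_sum D m n w)).
  by apply: measurableT_comp => //; exact: measurable_funM.
have := azuma_mgf lam Gm GS mD Dc D0 sE mn.
have lower : ((expR (lam * e))%:E * P (E `&` [set w | (e <= increment_sum D m n w)%R]) <=
    \int[P]_(w in E) (expR (lam * increment_sum D m n w))%:E)%E.
  rewrite -integral_cst//.
  apply: (@le_trans _ _ (\int[P]_(w in E `&` [set w | (e <= increment_sum D m n w)%R])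
      (expR (lam * increment_sum D m n w))%:E)%E).
    apply: ge0_le_integral => //.
    - by move=> w _; rewrite lee_fin expR_ge0.
    - exact/measurable_EFinP/measurable_funTS.
    - by move=> w [_ /= ew]; rewrite lee_fin ler_expR ler_pM2l.
  apply: ge0_subset_integral => //.
  - exact/measurable_EFinP/measurable_funTS.
move=> /(le_trans lower) H.
have eE : - (e ^+ 2 / (8 * V)) = 2 * lam ^+ 2 * V - lam * e.
  by rewrite /lam; field; rewrite gt_eqF.
rewrite eE expRD expRN.
rewrite -(@lee_pmul2l _ (expR (lam * e))%:E) ?lte_fin ?expR_gt0//.
apply: (le_trans H).
rewrite muleA -EFinM [(expR (lam * e) * _)%R]mulrC divfK ?gt_eqF ?expR_gt0//.
apply: lee_wpmul2r => //; rewrite lee_fin ler_expR ler_wpM2l//.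
by rewrite mulr_ge0 ?sqr_ge0.
Qed.

(** * Excursions of the noise *)

Lemma measurable_lt_set (dT : measure_display) (T : measurableType dT) (R : realType)
  (f : T -> R) (r : R) : measurable_fun setT f -> measurable [set w | f w < r].
Proof.
move=> mf; have -> : [set w | f w < r] = f @^-1` `]-oo, r[%classic.
  by apply/seteqP; split => w /=; rewrite in_itv.
by rewrite -[X in measurable X]setTI; exact: mf.
Qed.

Lemma measurable_le_set (dT : measure_display) (T : measurableType dT) (R : realType)
  (f : T -> R) (r : R) : measurable_fun setT f -> measurable [set w | f w <= r].
Proof.
move=> mf; have -> : [set w | f w <= r] = f @^-1` `]-oo, r]%classic.
  by apply/seteqP; split => w /=; rewrite in_itv.
by rewrite -[X in measurable X]setTI; exact: mf.
Qed.

Lemma measurable_fun_row_norm (dT : measure_display) (T : measurableType dT) (R : realType)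
  (d : nat) (Y : T -> 'rV[R]_d) :
  (forall i, measurable_fun setT (rv_coord Y i)) -> measurable_fun setT (fun w => `|Y w|).
Proof.
move=> mY; rewrite (_ : (fun w => `|Y w|) =
    (fun w => \big[Num.max/0]_(ij <- index_enum _) `|Y w (ij : 'I_1 * 'I_d).1 ij.2|)); last first.
  by apply/funext => w; rewrite [LHS]/Num.Def.normr/= mx_normrE.
elim: (index_enum _) => [|ij s IH].
  by under eq_fun do rewrite big_nil; exact: measurable_cst.
under eq_fun do rewrite big_cons; apply: measurable_maxr => //.
by apply: measurableT_comp => //; rewrite [ij.1]ord1; exact: mY.
Qed.

(* [<<s history X M n>>] is convertible to [nat_filtration X M n]. *)
Definition history (dT : measure_display) (T : measurableType dT)
  (R : realType) (d : nat) (X M : nat -> T -> 'rV[R]_d) (n : nat) : set (set T) :=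
  [set E | exists m : nat, exists i : 'I_d, (m <= n)%N /\
        ((exists2 B : set R, measurable B & E = rv_coord (X m) i @^-1` B) \/
         ((1 <= m)%N /\ exists2 B : set R, measurable B &
                                         E = rv_coord (M m) i @^-1` B))].

Lemma history_measurable (dT : measure_display) (T : measurableType dT) (R : realType) (d : nat)
  (X M : nat -> T -> 'rV[R]_d) n :
  (forall n (i : 'I_d), measurable_fun setT (rv_coord (X n) i)) ->
  (forall n (i : 'I_d), measurable_fun setT (rv_coord (M n) i)) ->
  <<s history X M n>> `<=` measurable.
Proof.
move=> mX mM; apply: smallest_sub; first exact: sigma_algebra_measurable.
move=> E [m [i [_ [[B mB ->]|[_ [B mB ->]]]]]].
  by rewrite -[X in measurable X]setTI; exact: mX.
by rewrite -[X in measurable X]setTI; exact: mM.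
Qed.

Lemma history_mono (dT : measure_display) (T : measurableType dT) (R : realType) (d : nat)
  (X M : nat -> T -> 'rV[R]_d) m n : (m <= n)%N -> <<s history X M m>> `<=` <<s history X M n>>.
Proof.
move=> mn; apply: sub_sigma_algebra2 => E [j [i [jm H]]].
by exists j, i; split => //; exact: leq_trans mn.
Qed.

Lemma history_state (dT : measure_display) (T : measurableType dT) (R : realType) (d : nat)
  (X M : nat -> T -> 'rV[R]_d) j n i : (j <= n)%N ->
  measurable_fun [set: g_sigma_algebraType (history X M n)] (rv_coord (X j) i).
Proof.
move=> jn _ B mB; rewrite setTI; apply: sub_sigma_algebra.
by exists j, i; split => //; left; exists B.
Qed.

Lemma history_noise (dT : measure_display) (T : measurableType dT) (R : realType) (d : nat)
  (X M : nat -> T -> 'rV[R]_d) j n i : (0 < j <= n)%N ->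
  measurable_fun [set: g_sigma_algebraType (history X M n)] (rv_coord (M j) i).
Proof.
move=> /andP[j0 jn] _ B mB; rewrite setTI; apply: sub_sigma_algebra.
by exists j, i; split => //; right; split => //; exists B.
Qed.

Definition noise (R : realType) (T : Type) (d : nat) (a : nat -> R) (M : nat -> T -> 'rV[R]_d)
  (m n : nat) (w : T) : 'rV[R]_d := \sum_(m <= k < n) a k *: M k.+1 w.

Lemma noise_coord (R : realType) (T : Type) (d : nat) (a : nat -> R) (M : nat -> T -> 'rV[R]_d)
  (m n : nat) (i : 'I_d) :
  rv_coord (noise a M m n) i = increment_sum (fun k w => a k * rv_coord (M k.+1) i w) m n.
Proof.
apply/funext => w; rewrite /rv_coord /noise /increment_sum summxE.
by apply: eq_bigr => k _; rewrite mxE.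
Qed.

(** The states strictly before [n] are required to be bounded: these are the ones that bound the
    noise increments summed up to [n]. *)
Definition noise_excursion (R : realType) (T : Type) (d : nat) (a : nat -> R)
  (X M : nat -> T -> 'rV[R]_d) (C e : R) (m n : nat) : set T :=
  [set w | e <= `|noise a M m n w|] `&`
  \bigcap_(j in [set j | (m <= j < n)%N]) [set w | `|X j w| <= C].

Lemma row_norm_attained (R : realType) (d : nat) (y : 'rV[R]_d) (e : R) :
  0 < e -> e <= `|y| -> exists i, e <= `|y ord0 i|.
Proof.
move=> e0 ey; apply: contrapT => /forallNP H.
suff : `|y| < e by rewrite ltNge ey.
rewrite [ltLHS]/Num.Def.normr/= mx_normrE; apply: bigmax_lt => // -[i j] _ /=.
by rewrite [i]ord1 ltNge; apply/negP; exact: H.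
Qed.

(** The noise bound holds almost surely and on bounded states, while the exponential estimate wants
    it at every point; truncation provides this. *)
Definition truncate (R : realType) (c y : R) : R := Num.max (- c) (Num.min c y).

Lemma truncate_id (R : realType) (c y : R) : `|y| <= c -> truncate c y = y.
Proof. by rewrite ler_norml /truncate => /andP[cy yc]; rewrite min_r// max_r. Qed.

Lemma truncate_le (R : realType) (c y : R) : 0 <= c -> `|truncate c y| <= c.
Proof.
move=> c0; rewrite ler_norml /truncate le_max lexx /= ge_max ge_min lexx /= andbT.
by lra.
Qed.

Lemma measurable_truncate (dT : measure_display) (T : measurableType dT) (R : realType)
  (c : R) (f : T -> R) : measurable_fun setT f -> measurable_fun setT (fun w => truncate c (f w)).
Proof.
by move=> mf; apply: measurable_maxr => //; apply: measurable_minr.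
Qed.

Lemma measurable_noise (dT : measure_display) (T : measurableType dT)
  (R : realType) (d : nat) (a : nat -> R) (M : nat -> T -> 'rV[R]_d) (m n : nat) :
  (forall k (i : 'I_d), (m <= k < n)%N -> measurable_fun setT (rv_coord (M k.+1) i)) ->
  measurable_fun setT (fun w => `|noise a M m n w|).
Proof.
move=> mM; apply: measurable_fun_row_norm => i; rewrite noise_coord.
by apply: measurable_increment_sum => k kn; apply: measurable_funM => //; exact: mM.
Qed.

Lemma measurable_noise_excursion (dT : measure_display) (T : measurableType dT)
  (R : realType) (d : nat) (a : nat -> R) (X M : nat -> T -> 'rV[R]_d) (C e : R) (m n : nat) :
  (forall n (i : 'I_d), measurable_fun setT (rv_coord (X n) i)) ->
  (forall n (i : 'I_d), measurable_fun setT (rv_coord (M n) i)) ->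
  measurable (noise_excursion a X M C e m n).
Proof.
move=> mX mM; apply: measurableI.
  have -> : [set w | e <= `|noise a M m n w|] = ~` [set w | `|noise a M m n w| < e].
    by apply/seteqP; split => w /=; rewrite leNgt => /negP.
  by apply: measurableC; apply: measurable_lt_set; apply: measurable_noise.
apply: bigcap_measurableType => j _; apply: measurable_le_set.
exact: measurable_fun_row_norm.
Qed.

(** This event is determined at time [k], so its indicator can multiply the noise [M k.+1] without
    spoiling the zero mean. *)
Definition pre_excursion (R : realType) (T : Type) (d : nat) (a : nat -> R)
  (X M : nat -> T -> 'rV[R]_d) (C e : R) (m k : nat) : set T :=
  if (m <= k)%N then
    \bigcap_(j in [set j | (m <= j <= k)%N])
      ([set w | `|noise a M m j w| < e] `&` [set w | `|X j w| <= C])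
  else set0.

Lemma history_pre_excursion (dT : measure_display) (T : measurableType dT)
  (R : realType) (d : nat) (a : nat -> R) (X M : nat -> T -> 'rV[R]_d) (C e : R) (m k : nat) :
  <<s history X M k>> (pre_excursion a X M C e m k).
Proof.
rewrite /pre_excursion; case: ifP => mk; last exact: (@measurable0 _ (g_sigma_algebraType _)).
apply: (@bigcap_measurableType _ (g_sigma_algebraType (history X M k))) => j /andP[mj jk].
apply: (@measurableI _ (g_sigma_algebraType (history X M k))).
  apply: (@measurable_lt_set _ (g_sigma_algebraType (history X M k))).
  apply: (@measurable_noise _ (g_sigma_algebraType (history X M k))) => l i /andP[_ lj].
  by apply: history_noise; rewrite /= (leq_trans lj).
apply: (@measurable_le_set _ (g_sigma_algebraType (history X M k))).
apply: (@measurable_fun_row_norm _ (g_sigma_algebraType (history X M k))) => i.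
exact: history_state.
Qed.

(* The increments are stopped at the first time the noise exceeds e, so that the
   tail bound at the final time controls the running maximum. *)
Definition stopped_increment (R : realType) (T : Type) (d : nat) (a : nat -> R)
  (X M : nat -> T -> 'rV[R]_d) (C e c : R) (m : nat) (s : R) (i : 'I_d) (k : nat) (w : T) : R :=
  s * a k * (\1_(pre_excursion a X M C e m k) w * truncate c (rv_coord (M k.+1) i w)).

Lemma stopped_increment_tail (dT : measure_display) (T : measurableType dT)
  (R : realType) (P : probability T R) (d : nat) (a : nat -> R) (X M : nat -> T -> 'rV[R]_d)
  (C e c V s : R) (N0 E : set T) (m : nat) (i : 'I_d) :
  (forall n (i : 'I_d), measurable_fun setT (rv_coord (X n) i)) ->
  (forall n (i : 'I_d), measurable_fun setT (rv_coord (M n) i)) ->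
  (forall n (i : 'I_d) (B : set T), <<s history X M n>> B ->
      (\int[P]_(w in B) (rv_coord (M n.+1) i w)%:E = 0)%E) ->
  measurable N0 -> P N0 = 0%E ->
  (forall w, ~ N0 w -> forall k, `|X k w| <= C -> `|M k.+1 w| <= c) ->
  (forall k, 0 < a k) -> 0 < c -> 0 < e -> 0 < V -> `|s| = 1 ->
  (forall n, \sum_(m <= k < n) a k ^+ 2 <= V) -> <<s history X M m>> E ->
  forall n, (m <= n)%N ->
  (P (E `&` [set w | (e <= increment_sum (stopped_increment a X M C e c m s i) m n w)%R]) <=
     (expR (- (e ^+ 2 / (8 * (c ^+ 2 * V)))))%:E * P E)%E.
Proof.
move=> mX mM M0 mN0 PN0 Mc a0 c0 e0 V0 s1 aV sE n mn.
have Hm n' := @history_measurable _ _ _ _ X M n' mX mM.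
have mH k : measurable (pre_excursion a X M C e m k).
  exact: (Hm k _ (@history_pre_excursion _ _ _ _ a X M C e m k)).
have mtr k j : measurable_fun setT (fun w => truncate c (rv_coord (M k) j w)).
  exact: measurable_truncate.
have absD k w : `|stopped_increment a X M C e c m s i k w| <= a k * c.
  rewrite /stopped_increment !normrM s1 mul1r (gtr0_norm (a0 k)) ler_pM2l// indicE.
  case: (_ \in _); last by rewrite normr0 mul0r ltW.
  by rewrite normr1 mul1r truncate_le// ltW.
apply: (@azuma_tail _ _ _ P (history X M) _ (fun k => a k * c)) => //.
- by move=> k; exact: history_mono.
- move=> k; apply: (@measurable_funM _ (g_sigma_algebraType (history X M k.+1))) => //.
  apply: (@measurable_funM _ (g_sigma_algebraType (history X M k.+1))) => //.
    apply: (@measurable_indic _ (g_sigma_algebraType (history X M k.+1))).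
    by apply: (history_mono (leqnSn k)); exact: history_pre_excursion.
  apply: (@measurable_truncate _ (g_sigma_algebraType (history X M k.+1))).
  by apply: history_noise; rewrite /=.
- move=> k B sB; have mB := Hm k B sB.
  pose H := pre_excursion a X M C e m k.
  pose f w := \1_H w * truncate c (rv_coord (M k.+1) i w).
  have intf : P.-integrable B (EFin \o f).
    apply: (@bounded_measurable_integrable _ _ _ _ _ _ c) => //.
      by apply: measurable_funM; [apply: measurable_indic; exact: mH|exact: mtr].
    move=> w; rewrite normrM indicE; case: (_ \in _); last by rewrite normr0 mul0r ltW.
    by rewrite normr1 mul1r truncate_le// ltW.
  rewrite (_ : (\int[P]_(w in B) _)%E = (\int[P]_(w in B) ((s * a k)%:E * (EFin \o f) w))%E); last first.
    by apply: eq_integral => w _; rewrite /stopped_increment /= -EFinM.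
  rewrite integralZl//.
  rewrite (_ : (\int[P]_(w in B) (EFin \o f) w)%E =
      (\int[P]_(w in B `&` H) (rv_coord (M k.+1) i w)%:E)%E).
    rewrite M0 ?mule0//.
    exact (@measurableI _ (g_sigma_algebraType (history X M k)) B H sB (@history_pre_excursion _ _ _ _ a X M C e m k)).
  transitivity (\int[P]_(w in B `&` H) (truncate c (rv_coord (M k.+1) i w))%:E)%E.
    rewrite integral_mkcondr; apply: eq_integral => w _.
    by rewrite /f patchE /= indicE; case: (w \in H); rewrite ?mul1r ?mul0r.
  have mBH : measurable (B `&` H) by apply: measurableI; [exact: mB|exact: mH].
  apply: ae_eq_integral => //.
  + by apply/measurable_EFinP/measurable_funTS.
  + by apply/measurable_EFinP/measurable_funTS.
  (* Outside [N0] and on [H], the state [X k] is bounded by [C], so the truncation at [c] changes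
     nothing. *)
  exists N0; split => // w /= /not_implyP[[_ Hw] neq]; apply: contrapT => nN0.
  apply: neq; congr (_%:E); apply: truncate_id.
  have XC : `|X k w| <= C.
    by move: Hw; rewrite /H /pre_excursion; case: ifP => // mk /(_ k) []; rewrite //= mk leqnn.
  apply: (le_trans _ (Mc w nN0 k XC)).
  by rewrite [leRHS]/Num.Def.normr/= mx_normrE; exact: (le_bigmax _ _ (ord0, i)).
- by rewrite mulr_gt0// exprn_gt0.
under eq_bigr do rewrite exprMn mulrC.
by rewrite -mulr_sumr ler_wpM2l// sqr_ge0.
Qed.

Lemma excursion_stopped_increment (R : realType) (T : Type) (d : nat) (a : nat -> R)
  (X M : nat -> T -> 'rV[R]_d) (C e c : R) (m n N : nat) (w : T) :
  0 < e -> (forall k, `|X k w| <= C -> `|M k.+1 w| <= c) -> (n <= N)%N ->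
  noise_excursion a X M C e m n w ->
  exists i s, (s = 1 \/ s = -1) /\
    e <= increment_sum (stopped_increment a X M C e c m s i) m N w.
Proof.
move=> e0 Mc nN [/= en XC].
(* At the first crossing [p] some coordinate is large; it and its sign give [i] and [s]. Increments
   from [p] on vanish, and earlier ones are neither stopped nor truncated. *)
have := ex_minnP (ex_intro (fun k => e <= `|noise a M m k w|) n en).
case=> p ep pmin.
have pn : (p <= n)%N by exact: pmin.
have mp : (m < p)%N.
  by rewrite ltnNge; apply/negP => pm; move: ep; rewrite /noise big_geq// normr0 leNgt e0.
have [i ei] := row_norm_attained e0 ep.
pose s : R := if 0 <= noise a M m p w ord0 i then 1 else -1.
exists i, s; split; first by rewrite /s; case: ifP => _; [left|right].
have -> : increment_sum (stopped_increment a X M C e c m s i) m N w = s * noise a M m p w ord0 i.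
  rewrite /increment_sum (@big_cat_nat _ _ _ p)//=; [|exact: ltnW|exact: leq_trans nN].
  rewrite [X in _ + X]big1_seq ?addr0; last first.
    move=> k /=; rewrite mem_index_iota => /andP[pk kN].
    rewrite /stopped_increment indicE memNset ?mul0r ?mulr0//.
    rewrite /pre_excursion (leq_trans (ltnW mp) pk) => /(_ p) [].
      by rewrite /= (ltnW mp) pk.
    by rewrite /= ltNge ep.
  have := congr1 (fun f => f w) (noise_coord a M m p i); rewrite /rv_coord => ->.
  rewrite /increment_sum mulr_sumr; apply: eq_big_nat => k /andP[mk kp].
  rewrite /stopped_increment indicE mem_set ?mul1r.
    rewrite truncate_id ?mulrA//.
    apply: (le_trans _ (Mc k _)).
      by rewrite [leRHS]/Num.Def.normr/= mx_normrE; exact: (le_bigmax _ _ (ord0, i)).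
    by apply: (XC k); rewrite /= mk (leq_trans kp).
  rewrite /pre_excursion mk => j /= /andP[mj jk]; split => /=.
    by rewrite ltNge; apply/negP => /pmin; rewrite leqNgt (leq_ltn_trans jk).
  by apply: (XC j); rewrite /= mj (leq_ltn_trans jk)// (leq_trans kp).
apply: (le_trans ei); rewrite /s; case: (leP 0) => h; first by rewrite mul1r ger0_norm.
by rewrite mulN1r ltr0_norm.
Qed.

Lemma noise_excursion_bound (dT : measure_display) (T : measurableType dT)
  (R : realType) (P : probability T R) (d : nat) (a : nat -> R) (X M : nat -> T -> 'rV[R]_d)
  (C e c V : R) (N0 E : set T) (m : nat) :
  (forall n (i : 'I_d), measurable_fun setT (rv_coord (X n) i)) ->
  (forall n (i : 'I_d), measurable_fun setT (rv_coord (M n) i)) ->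
  (forall n (i : 'I_d) (B : set T), <<s history X M n>> B ->
      (\int[P]_(w in B) (rv_coord (M n.+1) i w)%:E = 0)%E) ->
  measurable N0 -> P N0 = 0%E ->
  (forall w, ~ N0 w -> forall k, `|X k w| <= C -> `|M k.+1 w| <= c) ->
  (forall k, 0 < a k) -> 0 < c -> 0 < e -> 0 < V ->
  (forall n, \sum_(m <= k < n) a k ^+ 2 <= V) -> <<s history X M m>> E ->
  (P (E `&` \bigcup_n noise_excursion a X M C e m n) <=
     (2 * d%:R * expR (- (e ^+ 2 / (8 * (c ^+ 2 * V)))))%:E * P E)%E.
Proof.
move=> mX mM M0 mN0 PN0 Mc a0 c0 e0 V0 aV sE.
have mE : measurable E by exact: (history_measurable mX mM) sE.
have mexc n : measurable (noise_excursion a X M C e m n) by exact: measurable_noise_excursion.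
pose q := expR (- (e ^+ 2 / (8 * (c ^+ 2 * V)))).
pose F N := E `&` \bigcup_(n in [set k | (k <= N)%N]) noise_excursion a X M C e m n.
have mF N : measurable (F N) by apply: measurableI => //; apply: bigcup_measurable.
have UF : \bigcup_N F N = E `&` \bigcup_n noise_excursion a X M C e m n.
  apply/seteqP; split => [w [N _ [Ew [n _ nw]]]|w [Ew [n _ nw]]].
    by split => //; exists n.
  by exists n => //; split => //; exists n => /=.
have FN N : (m <= N)%N -> (P (F N) <= (2 * d%:R * q)%:E * P E)%E.
  move=> mN.
  pose tail s (i : 'I_d) :=
    E `&` [set w | (e <= increment_sum (stopped_increment a X M C e c m s i) m N w)%R].
  have tail_le s i : `|s| = 1 -> (P (tail s i) <= q%:E * P E)%E.
    by move=> s1; apply: (@stopped_increment_tail _ _ _ P _ a X M C e c V s N0 E m i).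
  have mtail s i : measurable (tail s i).
    apply: measurableI => //.
    have -> : [set w | e <= increment_sum (stopped_increment a X M C e c m s i) m N w] =
        ~` [set w | increment_sum (stopped_increment a X M C e c m s i) m N w < e].
      by apply/seteqP; split => w /=; rewrite leNgt => /negP.
    apply: measurableC; apply: measurable_lt_set; apply: measurable_increment_sum => k _.
    apply: measurable_funM => //; apply: measurable_funM; last exact: measurable_truncate.
    apply: measurable_indic; apply: (history_measurable (n := k) mX mM).
    exact: (@history_pre_excursion _ _ _ _ a X M C e m k).
  (* A union bound over [d.+1] events: one for each coordinate with both signs, and the index [d]
     for the null set [N0]. *)
  pose B k := if insub k is Some i then tail 1 i `|` tail (-1) i else N0.
  have mB k : measurable (B k).
    by rewrite /B; case: insubP => [i _ _|_] //; exact: measurableU.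
  apply: (@le_trans _ _ (\sum_(k < d.+1) P (B k))%E).
    apply: content_subadditive => // w [Ew [n nN nw]].
    rewrite -bigcup_mkord.
    have [N0w|nN0w] := pselect (N0 w).
      by exists d => //=; rewrite /B insubF// ltnn.
    have [i [s [s1 H]]] := @excursion_stopped_increment R T d a X M C e c m n N w e0 (Mc w nN0w) nN nw.
    exists i; first by rewrite /= ltnS ltnW.
    by rewrite /B valK; case: s1 => <-; [left|right].
  rewrite big_ord_recr/=.
  rewrite (_ : P (B d) = 0%E) ?adde0; last by rewrite /B insubF// ltnn.
  apply: (@le_trans _ _ (\sum_(k < d) (2 * q)%:E * P E)%E).
    apply: lee_sum => k _; rewrite /B valK (le_trans (measureU2 _ _ _))//.
    rewrite mulr2n mulrDl mul1r EFinD ge0_muleDl ?lee_fin ?expR_ge0//.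
    by apply: leeD; apply: tail_le; rewrite ?normrN normr1.
  have PEE : P E = (fine (P E))%:E by rewrite fineK// fin_num_measure.
  rewrite PEE; under eq_bigr do rewrite -EFinM.
  rewrite sumEFin -EFinM lee_fin sumr_const card_ord -mulr_natr.
  by rewrite le_eqVlt; apply/orP; left; apply/eqP; ring.
have /cvg_lim <- // : (P \o F) N @[N --> \oo] --> P (E `&` \bigcup_n noise_excursion a X M C e m n).
  rewrite -UF; apply: nondecreasing_cvg_mu => //; first exact: bigcup_measurable.
  move=> N N' NN'; apply/subsetPset => w [Ew [n nN nw]]; split => //; exists n => //.
  exact: leq_trans nN NN'.
apply: lime_le.
  apply: ereal_nondecreasing_is_cvgn => N N' NN'; apply: le_measure; rewrite ?inE//.
  move=> w [Ew [n nN nw]]; split => //; exists n => //; exact: leq_trans nN NN'.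
by exists m => // N /= mN; exact: FN.
Qed.

(** Outside the null set some starting index admits no further excursion of size [e]; for bounded
    states this is the Cauchy property of the noise series. It follows from the tail bound with the
    whole space as event, as the start tends to infinity. *)
Lemma recurrent_excursions_null (dT : measure_display) (T : measurableType dT)
  (R : realType) (P : probability T R) (d : nat) (a : nat -> R) (X M : nat -> T -> 'rV[R]_d)
  (C e c : R) (V : nat -> R) (N0 : set T) (m : nat) :
  (forall n (i : 'I_d), measurable_fun setT (rv_coord (X n) i)) ->
  (forall n (i : 'I_d), measurable_fun setT (rv_coord (M n) i)) ->
  (forall n (i : 'I_d) (B : set T), <<s history X M n>> B ->
      (\int[P]_(w in B) (rv_coord (M n.+1) i w)%:E = 0)%E) ->
  measurable N0 -> P N0 = 0%E ->
  (forall w, ~ N0 w -> forall k, `|X k w| <= C -> `|M k.+1 w| <= c) ->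
  (forall k, 0 < a k) -> 0 < c -> 0 < e -> (forall N, 0 < V N) ->
  (forall N n, \sum_(N <= k < n) a k ^+ 2 <= V N) -> V @ \oo --> 0 ->
  let Z := \bigcap_(N in [set N | (m <= N)%N]) \bigcup_n noise_excursion a X M C e N n in
  measurable Z /\ P Z = 0%E.
Proof.
move=> mX mM M0 mN0 PN0 Mc a0 c0 e0 V0 aV cV Z.
have mexc N n : measurable (noise_excursion a X M C e N n) by exact: measurable_noise_excursion.
have mU N : measurable (\bigcup_n noise_excursion a X M C e N n).
  by apply: bigcup_measurable => n _; exact: mexc.
have mZ : measurable Z by apply: bigcap_measurableType => N _; exact: mU.
split => //; apply/eqP; rewrite eq_le measure_ge0 andbT.
apply/lee_addgt0Pr => eps eps0; rewrite add0e.
(* Bounding [expR (- x)] by the inverse of [x] makes the tail bound linear in [V N], with this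
   factor. *)
pose k := 2 * d%:R * (8 * c ^+ 2 / e ^+ 2).
have k0 : 0 <= k.
  apply: mulr_ge0; first exact: mulr_ge0.
  by apply: divr_ge0; [apply: mulr_ge0 => //|]; exact: sqr_ge0.
have c20 : 0 < c ^+ 2 by rewrite exprn_gt0.
have e20 : 0 < e ^+ 2 by rewrite exprn_gt0.
have q0 : 0 < eps / (k + 1) by rewrite divr_gt0// ltr_wpDl.
have /cvgrPdist_lt/(_ _ q0)[N1 _ HN1] := cV.
pose N := maxn m N1.
have VN : V N < eps / (k + 1).
  have := HN1 N; rewrite /= leq_maxr => /(_ isT).
  by rewrite sub0r normrN ger0_norm ?ltW.
have sT : <<s history X M N>> [set: T] by exact: (@measurableT _ (g_sigma_algebraType (history X M N))).
have := noise_excursion_bound mX mM M0 mN0 PN0 Mc a0 c0 e0 (V0 N) (aV N) sT.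
rewrite setTI probability_setT mule1 => H.
apply: (@le_trans _ _ (P (\bigcup_n noise_excursion a X M C e N n))).
  by apply: le_measure; rewrite ?inE// => w /(_ N); apply; rewrite /= leq_maxl.
apply: (le_trans H); rewrite lee_fin.
pose x := e ^+ 2 / (8 * (c ^+ 2 * V N)).
have x0 : 0 < x by rewrite divr_gt0// mulr_gt0// mulr_gt0.
have expx : expR (- x) <= x^-1.
  rewrite expRN lef_pV2 ?posrE ?expR_gt0//.
  by have := expR_ge1Dx x; lra.
apply: (@le_trans _ _ (2 * d%:R * x^-1)); first by rewrite ler_wpM2l// mulr_ge0.
have -> : 2 * d%:R * x^-1 = k * V N.
  by rewrite /x /k; field; rewrite !gt_eqF.
apply: (@le_trans _ _ ((k + 1) * V N)); first by apply: ler_wpM2r; [exact: ltW|rewrite lerDl].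
by rewrite mulrC -ler_pdivlMr ?ltr_wpDl// ltW.
Qed.

(** * Measurability of the convergence event *)

(** Measurability is given by coordinates, so the open set is written as a countable union of
    sup-norm balls with rational centres. *)
Lemma measurable_preimage_open (dT : measure_display) (T : measurableType dT)
  (R : realType) (d : nat) (Y : T -> 'rV[R]_d) (O : set 'rV[R]_d) :
  (forall i, measurable_fun setT (rv_coord Y i)) -> open O -> measurable (Y @^-1` O).
Proof.
move=> mY oO.
pose q (p : 'rV[rat]_d) : 'rV[R]_d := map_mx ratr p.
pose box (pk : 'rV[rat]_d * nat) : set 'rV[R]_d := [set y | `|y - q pk.1| < pk.2.+1%:R^-1].
pose U pk : set T := if `[< box pk `<=` O >] then Y @^-1` box pk else set0.
have -> : Y @^-1` O = \bigcup_pk U pk.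
  apply/seteqP; split => w /=; last first.
    by move=> [pk _]; rewrite /U; case: asboolP => // sub; exact: sub.
  move=> OYw; have /nbhs_ballP[e /= e0 He] : nbhs (Y w) O by exact: open_nbhs_nbhs.
  have [k ke] : exists k : nat, k.+1%:R^-1 < e / 2.
    have e20 : 0 < e / 2 by rewrite divr_gt0.
    have /cvgrPdist_lt/(_ _ e20)[k _ Hk] := @cvg_harmonic R.
    exists k; have := Hk k (leqnn k); rewrite sub0r normrN.
    by apply: le_lt_trans; exact: ler_norm.
  have k0 : 0 < k.+1%:R^-1 :> R by rewrite invr_gt0.
  have rat_near i : exists r : rat, `|Y w ord0 i - ratr r| < k.+1%:R^-1.
    move: (k.+1%:R^-1 : R) k0 => t t0.
    have [|r] := @rat_in_itvoo R (Y w ord0 i - t) (Y w ord0 i + t); first lra.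
    by rewrite in_itv /= => /andP[h1 h2]; exists r; rewrite ltr_norml; apply/andP; split; lra.
  have [r rP] := choice rat_near.
  have close : `|Y w - q (\row_i r i)| < k.+1%:R^-1.
    rewrite [ltLHS]/Num.Def.normr/= mx_normrE; apply: bigmax_lt => // -[i j] _ /=.
    by rewrite !mxE [i]ord1; exact: rP.
  exists (\row_i r i, k) => //; rewrite /U; case: asboolP => // -[] y /= yq.
  apply: He; rewrite -ball_normE /=.
  have := ler_normD (Y w - q (\row_i r i)) (q (\row_i r i) - y); rewrite subrKA.
  by rewrite [`|q _ - y|]distrC; move: yq; rewrite /box /=; move: (k.+1%:R^-1 : R) ke close => t *; lra.
apply: countable_bigcupT_measurable; first exact: countableP.
move=> pk; rewrite /U; case: ifP => // _.
apply: measurable_lt_set; apply: measurable_fun_row_norm => i.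
rewrite (_ : rv_coord _ i = rv_coord Y i \- cst (q pk.1 ord0 i)).
  exact: measurable_funB.
by apply/funext => w; rewrite /rv_coord !mxE.
Qed.

Lemma eps_nbhd_open (R : realType) (d : nat) (A : set 'rV[R]_d) (e : R) : open (eps_nbhd A e).
Proof.
have -> : eps_nbhd A e = \bigcup_(c in A) ball c e.
  apply/seteqP; split => y /= [c Ac yc]; exists c => //.
    by rewrite -ball_normE /= distrC.
  by move: yc; rewrite -ball_normE /= distrC.
by apply: bigcup_open => c _; exact: ball_open.
Qed.

Lemma dist_set_ge0 (R : realType) (d : nat) (A : set 'rV[R]_d) x : 0 <= dist_set x A.
Proof.
have [[c Ac]|A0] := pselect (A !=set0).
  by apply: lb_le_inf; [exists `|x - c|, c|move=> _ [? _ <-]].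
rewrite /dist_set (_ : A = set0) ?image_set0 ?inf0//.
by apply/seteqP; split => // y Ay; exfalso; apply: A0; exists y.
Qed.

Lemma dist_set_lt (R : realType) (d : nat) (A : set 'rV[R]_d) x e :
  eps_nbhd A e x -> dist_set x A < e.
Proof.
move=> [c Ac xc]; apply: le_lt_trans xc; apply: ge_inf; last by exists c.
by exists 0 => _ [? _ <-].
Qed.

Lemma dist_set_lt_eps_nbhd (R : realType) (d : nat) (A : set 'rV[R]_d) x e :
  A !=set0 -> dist_set x A < e -> eps_nbhd A e x.
Proof.
move=> [c Ac] /inf_lt[|_ [b Ab <-] be]; last by exists b.
by exists `|x - c|, c.
Qed.

Lemma dist_set_cvg0 (R : realType) (d : nat) (A : set 'rV[R]_d) (x : nat -> 'rV[R]_d) :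
  (forall e, 0 < e -> exists N, forall n, (N <= n)%N -> eps_nbhd A e (x n)) ->
  (fun n => dist_set (x n) A) @ \oo --> 0.
Proof.
move=> H; apply/cvgrPdist_lt => e e0; have [N HN] := H e e0.
exists N => // n /= Nn; rewrite sub0r normrN ger0_norm ?dist_set_ge0//.
by apply: dist_set_lt; exact: HN.
Qed.

Lemma measurable_dist_cvg0 (dT : measure_display) (T : measurableType dT)
  (R : realType) (d : nat) (X : nat -> T -> 'rV[R]_d) (A : set 'rV[R]_d) :
  (forall n (i : 'I_d), measurable_fun setT (rv_coord (X n) i)) ->
  measurable [set w | (fun n => dist_set (X n w) A) @ \oo --> 0].
Proof.
(* For empty [A] the distance is the infimum of the empty set, which is 0 by convention, so the
   event is everything. *)
move=> mX; have [A0|A0] := pselect (A !=set0); last first.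
  rewrite (_ : [set w | _] = setT)//; apply/seteqP; split => // w _ /=.
  rewrite (_ : (fun n => _) = cst 0); first exact: cvg_cst.
  apply/funext => n; rewrite /dist_set (_ : A = set0) ?image_set0 ?inf0//.
  by apply/seteqP; split => // y Ay; exfalso; apply: A0; exists y.
have -> : [set w | (fun n => dist_set (X n w) A) @ \oo --> 0] =
    \bigcap_p \bigcup_N \bigcap_(n in [set n | (N <= n)%N]) (X n @^-1` eps_nbhd A p.+1%:R^-1).
  apply/seteqP; split => w /=.
    move=> cvg0 p _; have p0 : 0 < p.+1%:R^-1 :> R by rewrite invr_gt0.
    have /cvgrPdist_lt/(_ _ p0)[N _ HN] := cvg0.
    exists N => // n /= Nn; apply: dist_set_lt_eps_nbhd => //.
    have := HN n Nn; rewrite sub0r normrN; apply: le_lt_trans; exact: ler_norm.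
  move=> H; apply: dist_set_cvg0 => e e0.
  have /cvgrPdist_lt/(_ _ e0)[p _ Hp] := @cvg_harmonic R.
  have [N _ HN] := H p I; exists N => n Nn; have [c Ac cn] := HN n Nn.
  exists c => //; apply: (lt_trans cn).
  have := Hp p (leqnn p); rewrite sub0r normrN; apply: le_lt_trans; exact: ler_norm.
apply: bigcap_measurableType => p _; apply: bigcup_measurable => N _.
apply: bigcap_measurableType => n _; apply: measurable_preimage_open => //.
exact: eps_nbhd_open.
Qed.

(** * Step sizes and tails of the squared steps *)

Lemma path_time_unbounded (R : realType) (a : nat -> R) : (forall n, 0 < a n) ->
  (\sum_(k <oo) (a k)%:E = +oo)%E -> forall B, exists k, B < path_time a k.
Proof.
move=> a0 sa B; apply: contrapT => /forallNP H.
suff : (\sum_(k <oo) (a k)%:E <= B%:E)%E by rewrite sa leye_eq.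
apply: lime_le; first by apply: is_cvg_nneseries => n _ _; rewrite lee_fin ltW.
by apply: nearW => n; rewrite sumEFin lee_fin leNgt; apply/negP; exact: H.
Qed.

Lemma sq_sum_bounded (R : realType) (a : nat -> R) :
  (\sum_(k <oo) (a k ^+ 2)%:E < +oo)%E ->
  exists W, forall m n, \sum_(m <= k < n) a k ^+ 2 <= W.
Proof.
move=> sa; have sa0 : (0 <= \sum_(k <oo) (a k ^+ 2)%:E)%E.
  by apply: nneseries_ge0 => n _ _; rewrite lee_fin sqr_ge0.
have safin : (\sum_(k <oo) (a k ^+ 2)%:E)%E \is a fin_num by rewrite ge0_fin_numE.
exists (fine (\sum_(k <oo) (a k ^+ 2)%:E)%E) => m n.
rewrite -lee_fin fineK//.
apply: (@le_trans _ _ (\sum_(0 <= k < n) (a k ^+ 2)%:E)%E); last first.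
  by apply: nneseries_lim_ge => k _; rewrite lee_fin sqr_ge0.
rewrite sumEFin lee_fin.
have [mn|nm] := leqP m n; last first.
  by rewrite big_geq ?(ltnW nm)// sumr_ge0// => i _; exact: sqr_ge0.
rewrite [leRHS](@big_cat_nat _ _ _ m)//= lerDr.
by rewrite sumr_ge0// => i _; exact: sqr_ge0.
Qed.

Lemma tail_sq_cvg (R : realType) (a : nat -> R) (m : nat) :
  (\sum_(k <oo) (a k ^+ 2)%:E < +oo)%E ->
  cvgn (fun N => \sum_(m <= k < N) a k ^+ 2).
Proof.
move=> /sq_sum_bounded[W HW]; apply: nondecreasing_is_cvgn; last first.
  by exists W => _ [n _ <-].
apply/nondecreasing_seqP => n; have [mn|nm] := leqP m n.
  by rewrite big_nat_recr//= lerDl sqr_ge0.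
by rewrite !big_geq// ltnW.
Qed.

Lemma tail_sq_ge (R : realType) (a : nat -> R) (m n : nat) :
  (\sum_(k <oo) (a k ^+ 2)%:E < +oo)%E -> \sum_(m <= k < n) a k ^+ 2 <= tail_sq a m.
Proof.
move=> sa; apply: (nondecreasing_cvgn_le _ (tail_sq_cvg sa)).
apply/nondecreasing_seqP => N; have [mn|nm] := leqP m N.
  by rewrite big_nat_recr//= lerDl sqr_ge0.
by rewrite !big_geq// ltnW.
Qed.

Lemma tail_sq_gt0 (R : realType) (a : nat -> R) (m : nat) : (forall n, 0 < a n) ->
  (\sum_(k <oo) (a k ^+ 2)%:E < +oo)%E -> 0 < tail_sq a m.
Proof.
move=> a0 sa; apply: lt_le_trans (@tail_sq_ge R a m m.+1 sa).
by rewrite big_nat1 exprn_gt0.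
Qed.

Lemma tail_sq_cvg0 (R : realType) (a : nat -> R) :
  (\sum_(k <oo) (a k ^+ 2)%:E < +oo)%E -> tail_sq a @ \oo --> 0.
Proof.
move=> sa; have c0 := @tail_sq_cvg R a 0 sa.
set u := (fun N => _) in c0.
have -> : tail_sq a = (fun m => limn u - u m).
  apply/funext => m; apply/cvg_lim => //.
  have : (fun N => u N - u m) @ \oo --> limn u - u m by apply: cvgB => //; exact: cvg_cst.
  apply: cvg_trans; apply: near_eq_cvg; exists m => // N /= mN.
  by rewrite /u (@big_cat_nat _ _ _ m 0 N)//= addrAC subrr add0r.
by rewrite -(subrr (limn u)); apply: cvgB => //; exact: cvg_cst.
Qed.

Lemma step_cvg0 (R : realType) (a : nat -> R) : (forall n, 0 < a n) ->
  (\sum_(k <oo) (a k ^+ 2)%:E < +oo)%E ->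
  forall e, 0 < e -> exists N, forall n, (N <= n)%N -> a n <= e.
Proof.
move=> a0 sa e e0; have e20 : 0 < e ^+ 2 by rewrite exprn_gt0.
have /cvgrPdist_lt/(_ _ e20)[N _ HN] := tail_sq_cvg0 sa.
exists N => n Nn; have an0 := ltW (a0 n); have e0' := ltW e0; rewrite -ler_sqr ?nnegrE//.
have := HN n Nn; rewrite /= sub0r normrN (gtr0_norm (@tail_sq_gt0 R a n a0 sa)) => tl.
apply: le_trans (ltW tl).
by have := @tail_sq_ge R a n n.+1 sa; rewrite big_nat1.
Qed.

(** * From noise excursions to convergence of trajectories *)

Lemma noise_split (R : realType) (T : Type) (d : nat) (a : nat -> R) (M : nat -> T -> 'rV[R]_d)
  (m p n : nat) (w : T) : (m <= p)%N -> (p <= n)%N ->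
  noise a M m n w = noise a M m p w + noise a M p n w.
Proof. by move=> mp pn; rewrite /noise (@big_cat_nat _ _ _ p). Qed.

Lemma noise_step (R : realType) (T : Type) (d : nat) (a : nat -> R) (M : nat -> T -> 'rV[R]_d)
  (m n : nat) (w : T) : (m <= n)%N ->
  noise a M m n.+1 w = noise a M m n w + a n *: M n.+1 w.
Proof. by move=> mn; rewrite /noise big_nat_recr. Qed.

(** The pathwise half of the theorem: without an excursion from [n0], the noise never reaches
    [rho / 2]. Half of [rho] is taken because lock-in bounds differences of partial sums. *)
Lemma lock_in_trajectory (R : realType) (d : nat) (T : Type) (F : 'rV[R]_d -> set 'rV[R]_d) (K : R)
  (A O O' : set 'rV[R]_d) :
  (forall x, F x !=set0 /\ convex_set_rV (F x) /\ compact (F x)) ->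
  0 < K -> (forall u v, F u v -> `|v| <= K * (1 + `|u|)) -> closed_graph F ->
  attracting_set_with F A O ->
  open O' -> A `<=` O' -> compact (closure O') -> closure O' `<=` O ->
  exists2 rho : R, 0 < rho & exists C : R,
    forall (a : nat -> R) (X M : nat -> T -> 'rV[R]_d) (n0 : nat) (w : T),
      (forall k, 0 < a k) -> (forall B, exists k, B < path_time a k) ->
      (forall e, 0 < e -> exists N, forall n, (N <= n)%N -> a n <= e) ->
      (forall n, exists2 y, F (X n w) y & X n.+1 w - X n w - a n *: M n.+1 w = a n *: y) ->
      (forall k, (n0 <= k)%N -> a k <= rho) -> O' (X n0 w) ->
      (forall n, ~ noise_excursion a X M C (rho / 2) n0 n w) ->
      (forall e, 0 < e -> exists2 N, (n0 <= N)%N &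
         forall n, ~ noise_excursion a X M C e N n w) ->
      forall e, 0 < e -> exists N, forall n, (N <= n)%N -> eps_nbhd A e (X n w).
Proof.
move=> FA K0 FK clF attA oO' AO' cO' O'O.
have [rho /andP[rho0 rho1] [C lockC]] := lock_in FA K0 FK clF attA oO' AO' cO' O'O.
exists rho => //; exists C => a X M n0 w a0 div a_small XF arho O'X noexc cauchy.
pose a' k := a (n0 + k)%N; pose x k := X (n0 + k)%N w; pose S k := noise a M n0 (n0 + k) w.
have a'0 k : 0 < a' k by exact: a0.
have div' : forall B, exists k, B < path_time a' k by exact: (path_time_shift_unbounded n0 a0 div).
have a'rho k : a' k <= rho by apply: arho; rewrite leq_addr.
have xS k : exists2 y, F (x k) y & x k.+1 = x k + a' k *: y + (S k.+1 - S k).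
  have [y Fy yE] := XF (n0 + k)%N; exists y => //.
  rewrite /x /S /a' addnS noise_step ?leq_addr// -yE.
  by apply/rowP => i; rewrite !mxE; ring.
have x0 : O' (x 0%N) by rewrite /x addn0.
have S0 : S 0%N = 0 by rewrite /S /noise addn0 big_geq.
have rho2 : 0 < rho / 2 by rewrite divr_gt0.
have Ssmall k : `|S k| < rho / 2.
  rewrite ltNge; apply/negP => Hk.
  (* At a first crossing [m.+1], the path with noise frozen at [m] satisfies lock-in, so the states
     up to [m] are bounded by [C]. These are exactly the states that an excursion at [m.+1] asks
     about, which contradicts [noexc]. *)
  have := ex_minnP (ex_intro (fun k => rho / 2 <= `|S k|) k Hk); case=> -[|m] Sm mmin.
    by move: Sm; rewrite S0 normr0 leNgt rho2.
  have Sle j : `|S (minn j m)| <= rho / 2.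
    rewrite leNgt; apply/negP => /ltW/mmin; rewrite ltnNge geq_minr//.
  have [x' x'x x'S] := @DI_path_extend R d F a' x S m (fun u => (FA u).1) (fun k _ => xS k).
  have [||x'C _] := lockC a' x' _ a'0 div' a'rho x'S.
  - move=> i j; rewrite (le_trans (ler_normB _ _))//.
    by have := Sle i; have := Sle j; lra.
  - by rewrite x'x.
  apply: (noexc (n0 + m.+1)%N); split => // j /= /andP[n0j jm].
  have := x'C (j - n0)%N; rewrite x'x ?/x ?subnKC// leq_subLR.
  by move: jm; rewrite addnS ltnS.
have [||xC conv] := lockC a' x S a'0 div' a'rho xS.
- move=> i j; rewrite (le_trans (ler_normB _ _))//.
  by have := Ssmall i; have := Ssmall j; lra.
- exact: x0.
have XC j : (n0 <= j)%N -> `|X j w| <= C.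
  by move=> n0j; have := xC (j - n0)%N; rewrite /x subnKC.
move=> e e0; have [|N HN] := conv _ e e0.
  move=> e' e'0; have e'2 : 0 < e' / 2 by rewrite divr_gt0.
  have [N1 HN1] := a_small e' e'0; have [N2 n0N2 HN2] := cauchy _ e'2.
  (* All states are now known to be bounded by [C], so large noise after [N2] would be an
     excursion. *)
  have small n : `|noise a M N2 n w| < e' / 2.
    rewrite ltNge; apply/negP => Hn; apply: (HN2 n); split => // j /= /andP[N2j _].
    by apply: XC; exact: leq_trans N2j.
  exists (maxn N1 N2) => j k; rewrite !geq_max => /andP[N1j N2j] /andP[N1k N2k]; split.
    by apply: HN1; rewrite (leq_trans N1k)// leq_addl.
  rewrite /S (@noise_split _ _ _ _ _ n0 N2 (n0 + j))//; last by rewrite (leq_trans N2j)// leq_addl.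
  rewrite (@noise_split _ _ _ _ _ n0 N2 (n0 + k))//; last by rewrite (leq_trans N2k)// leq_addl.
  rewrite (_ : _ - _ = noise a M N2 (n0 + j) w - noise a M N2 (n0 + k) w); last first.
    by apply/rowP => i; rewrite !mxE; ring.
  rewrite (le_trans (ler_normB _ _))//.
  by have := small (n0 + j)%N; have := small (n0 + k)%N; lra.
exists (n0 + N)%N => n Nn; have n0n : (n0 <= n)%N by rewrite (leq_trans _ Nn)// leq_addr.
by have := HN (n - n0)%N; rewrite /x subnKC//; apply; rewrite leq_subRL.
Qed.

Unset Implicit Arguments.

Theorem theorem2 (R : realType) (d : nat) (dT : measure_display)
  (T : measurableType dT) (P : probability T R)
  (X M : nat -> T -> 'rV[R]_d) (F : 'rV[R]_d -> set 'rV[R]_d)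
  (a : nat -> R) (A O O' : set 'rV[R]_d) :
  (* X_n, M_n are R^d-valued random variables *)
  (forall n (i : 'I_d), measurable_fun setT (rv_coord (X n) i)) ->
  (forall n (i : 'I_d), measurable_fun setT (rv_coord (M n) i)) ->
  (* the stochastic recursive inclusion *)
  (forall n w, exists2 y, F (X n w) y &
      X n.+1 w - X n w - a n *: M n.+1 w = a n *: y) ->
  (* (A1) *)
  (forall x, F x !=set0 /\ convex_set_rV (F x) /\ compact (F x)) ->
  (exists2 K : R, 0 < K &
      forall x y, F x y -> `|y| <= K * (1 + `|x|)) ->
  closed_graph F ->
  (* (A2) *)
  (forall n, 0 < a n) ->
  (\sum_(k <oo) (a k)%:E = +oo)%E ->
  (\sum_(k <oo) (a k ^+ 2)%:E < +oo)%E ->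
  (* (A3) martingale difference sequence w.r.t. F_n = sigma(X_m, M_m, m <= n) *)
  (forall n (i : 'I_d), P.-integrable setT (EFin \o rv_coord (M n.+1) i)) ->
  (forall n (i : 'I_d) (B : set T), nat_filtration X M n B ->
      (\int[P]_(w in B) (rv_coord (M n.+1) i w)%:E = 0)%E) ->
  (exists2 K : R, 0 < K & forall n,
      {ae P, forall w, `|M n.+1 w| <= K * (1 + `|X n w|)}) ->
  (* (A4) *)
  attracting_set_with F A O ->
  (* the neighbourhood O' *)
  open O' -> A `<=` O' -> compact (closure O') -> closure O' `<=` O ->
  exists2 Kt : R, 0 < Kt & exists2 N0 : nat, (1 <= N0)%N &
    forall (n0 : nat) (E : set T), (N0 <= n0)%N ->
      nat_filtration X M n0 E ->
      E `<=` [set w | O' (X n0 w)] ->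
      (0 < P E)%E ->
      1 - 2 * d%:R * expR (- Kt / tail_sq a n0)
        <= cond_prob P [set w | (fun n => dist_set (X n w) A) @ \oo --> 0] E.

Proof.
move=> mX mM XF FA [K K0 FK] clF a0 suma suma2 intM M0 [K2 K20 MK] attA oO' AO' cO' O'O.
have [rho rho0 [C lockC]] := @lock_in_trajectory R d T F K A O O' FA K0 FK clF attA oO' AO' cO' O'O.
(* The absolute value makes [c] positive whatever the sign of [C]. *)
pose c := K2 * (1 + `|C|).
have c0 : 0 < c by rewrite mulr_gt0// ltr_pwDl.
have /ae_foralln[N0 [mN0 PN0 subN0]] := MK.
have Mc w : ~ N0 w -> forall k, `|X k w| <= C -> `|M k.+1 w| <= c.
  move=> nN0 k XC; have : `|M k.+1 w| <= K2 * (1 + `|X k w|).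
    by apply: contrapT => nM; apply: nN0; apply: subN0 => /(_ k).
  by move=> /le_trans; apply; rewrite ler_pM2l// lerD2l (le_trans XC)// ler_norm.
have rho2 : 0 < rho / 2 by rewrite divr_gt0.
have div := path_time_unbounded a0 suma.
have a_small := step_cvg0 a0 suma2.
have [N1 HN1] := a_small _ rho0.
have V0 N : 0 < tail_sq a N by exact: tail_sq_gt0.
have aV N n : \sum_(N <= k < n) a k ^+ 2 <= tail_sq a N by exact: tail_sq_ge.
(* The exponent of the excursion bound at threshold [rho / 2] with [tail_sq a n0] as variance bound,
   multiplied by that tail. *)
exists ((rho / 2) ^+ 2 / (8 * c ^+ 2)).
  by rewrite divr_gt0 ?exprn_gt0// mulr_gt0// exprn_gt0.
exists N1.+1 => // n0 E N1n0 sE EO' PE0.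
have mE : measurable E by exact: (history_measurable mX mM) sE.
pose exc := \bigcup_n noise_excursion a X M C (rho / 2) n0 n.
have mexc : measurable exc.
  by apply: bigcup_measurable => n _; exact: measurable_noise_excursion.
(* Countably many thresholds suffice, since an excursion of some size is also one of every smaller
   positive size. *)
pose Z p := \bigcap_(N in [set N | (n0 <= N)%N])
  \bigcup_n noise_excursion a X M C p.+1%:R^-1 N n.
have Znull p : measurable (Z p) /\ P (Z p) = 0%E.
  have p0 : 0 < p.+1%:R^-1 :> R by rewrite invr_gt0.
  exact: (@recurrent_excursions_null _ _ _ _ _ a X M C _ c (tail_sq a) N0 n0
    mX mM M0 mN0 PN0 Mc a0 c0 p0 V0 aV (tail_sq_cvg0 suma2)).
have mZ : measurable (\bigcup_p Z p) by apply: bigcup_measurable => p _; exact: (Znull p).1.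
have PZ : P (\bigcup_p Z p) = 0%E.
  apply: measure_negligible => //; apply: negligible_bigcup => p.
  by exists (Z p); split; [exact: (Znull p).1|exact: (Znull p).2|].
have PEexc := noise_excursion_bound mX mM M0 mN0 PN0 Mc a0 c0 rho2 (V0 n0) (aV n0) sE.
rewrite (_ : - ((rho / 2) ^+ 2 / (8 * (c ^+ 2 * tail_sq a n0))) =
  - ((rho / 2) ^+ 2 / (8 * c ^+ 2)) / tail_sq a n0) in PEexc; last first.
  by field; rewrite !gt_eqF.
set q := 2 * d%:R * expR _ in PEexc *.
set conv := [set w | _].
have mconv : measurable conv by exact: measurable_dist_cvg0.
(* Up to the null set, a trajectory starting in [E] can fail to converge only through an excursion
   after [n0]. *)
have cover : E `<=` (conv `&` E) `|` ((E `&` exc) `|` \bigcup_p Z p).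
  move=> w Ew; have [excw|nexc] := pselect (exc w); first by right; left.
  have [Zw|nZ] := pselect ((\bigcup_p Z p) w); first by right; right.
  left; split => //; apply: dist_set_cvg0.
  apply: (lockC a X M n0 w a0 div a_small (fun n => XF n w)).
  - by move=> k n0k; apply: HN1; rewrite (leq_trans _ n0k)// ltnW.
  - exact: EO'.
  - by move=> n excn; apply: nexc; exists n.
  move=> e e0; have /cvgrPdist_lt/(_ _ e0)[p _ Hp] := @cvg_harmonic R.
  have pe : p.+1%:R^-1 < e.
    have := Hp p (leqnn p); rewrite sub0r normrN; apply: le_lt_trans; exact: ler_norm.
  have nZp : ~ Z p w by move=> Zp; apply: nZ; exists p.
  apply: contrapT => H; apply: nZp => N /= n0N; apply: contrapT => nexcN.
  apply: H; exists N => // n [en XC]; apply: nexcN; exists n => //; split => //=.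
  by rewrite (le_trans (ltW pe)).
have PEle : (P E <= P (conv `&` E) + q%:E * P E)%E.
  apply: (@le_trans _ _ (P ((conv `&` E) `|` ((E `&` exc) `|` \bigcup_p Z p)))).
    by apply: le_measure; rewrite ?inE//; do ?apply: measurableU; do ?apply: measurableI.
  apply: (le_trans (measureU2 _ _ _)); [exact: measurableI| |].
    by apply: measurableU => //; exact: measurableI.
  apply: leeD => //; apply: le_trans PEexc.
  apply: (le_trans (measureU2 _ _ _)) => //; first exact: measurableI.
  rewrite -[X in (_ <= X)%E]adde0; apply: leeD => //.
  by rewrite le_eqVlt; apply/orP; left; apply/eqP; exact: PZ.
have finE : P E \is a fin_num by exact: fin_num_measure.
have finC : P (conv `&` E) \is a fin_num by apply: fin_num_measure; exact: measurableI.
rewrite /cond_prob -/conv.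
move: PEle PE0; rewrite -(fineK finE) -(fineK finC) -EFinM -EFinD lee_fin lte_fin /=.
move=> PEle PE0; rewrite ler_pdivlMr// mulrBl mul1r; lra.
Qed.
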